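(* Let $K=\prod_{i,j\ge1}\dfrac1{1-x_iy_j-\theta_i\phi_j}$. Then $$K=\sum_\Lambda\overleftarrow{m_\Lambda(x,\theta)}\;h_\Lambda(y,\phi),$$ the sum running over all superpartitions $\Lambda$.
   Context: $x_i,y_j$ ($i,j\ge1$) are commuting variables; $\theta_i,\phi_j$ are mutually anticommuting variables (each squares to zero, any two of them anticommute), commuting with the $x_i,y_j$. A superpartition of $(n|m)$ is $\Lambda=(\Lambda_1,\dots,\Lambda_m;\Lambda_{m+1},\Lambda_{m+2},\dots)$ with nonnegative integer entries, $\Lambda_1>\dots>\Lambda_m\ge 0$, $\Lambda_{m+1}\ge\Lambda_{m+2}\ge\dots\ge0$ (finitely many nonzero; trailing zeros after the semicolon ignored) and $\sum_i\Lambda_i=n$; $\ell(\Lambda)=m+\#\{i>m:\Lambda_i>0\}$. The supermonomial $m_\Lambda(x,\theta)$ is the sum of all distinct terms obtained from $\theta_1\cdots\theta_m x_1^{\Lambda_1}x_2^{\Lambda_2}\cdots$ by simultaneous permutations of the pairs $(x_i,\theta_i)$. The functions $h_n,\tilde h_n$ are defined by $\sum_{n\ge0}t^n\bigl(h_n(x)+\tau\tilde h_n(x,\theta)\bigr)=\prod_i(1-tx_i-\tau\theta_i)^{-1}$ ($t$ commuting, $\tau$ anticommuting), and $h_\Lambda=\tilde h_{\Lambda_1}\cdots\tilde h_{\Lambda_m}h_{\Lambda_{m+1}}\cdots h_{\Lambda_{\ell(\Lambda)}}$. For $f(x,\theta)$ homogeneous of degree $m$ in $\theta$, $\overleftarrow{f}=(-1)^{m(m-1)/2}f$.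 *)

(* Defs.v *)
From HB Require Import structures.
From mathcomp Require Import all_boot all_order all_algebra.
From mathcomp Require Import finmap multiset.
From mathcomp Require Import boolp classical_sets functions cardinality fsbigop.

Set Implicit Arguments.
Unset Strict Implicit.
Unset Printing Implicit Defensive.

Import GRing.Theory.

Local Open Scope classical_set_scope.
Local Open Scope fset_scope.
Local Open Scope mset_scope.
Local Open Scope ring_scope.

(* Formal power series in commuting variables z_a and anticommuting variables
   zeta_a, both indexed by pairs a = (k, i) of natural numbers. The pair of
   alphabets number k is (t, tau) for k = 0 (only i = 0 is used),
   (x_i, theta_i) for k = 1 and (y_i, phi_i) for k = 2; i starts at 0. *)
Definition letter : Type := nat * nat.
HB.instance Definition _ := Countable.on letter.

Definition letter_lt (a b : letter) : bool :=
  (a.1 < b.1)%N || (a.1 == b.1) && (a.2 < b.2)%N.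

(* (e, S) stands for the monomial \prod_(a in e) z_a * \prod_(a in S) zeta_a,
   where the zeta_a are multiplied in increasing order for letter_lt. *)
Definition smonom : Type := {mset letter} * {fset letter}.
HB.instance Definition _ := Choice.on smonom.

Definition smonom1 : smonom := (mset0, fset0).
Definition smonomM (u v : smonom) : smonom := (u.1 `+` v.1, u.2 `|` v.2)%fset.

Record superseries (R : comNzRingType) : Type :=
  Superseries { scoef :> smonom -> R }.
HB.instance Definition _ (R : comNzRingType) := gen_eqMixin (superseries R).
HB.instance Definition _ (R : comNzRingType) := gen_choiceMixin (superseries R).

(* zeta_A * zeta_B = ssign A B * zeta_(A `|` B): zero if a variable is
   repeated, and one sign change per pair that has to be exchanged. *)
Definition ssign (R : comNzRingType) (A B : {fset letter}) : R :=
  if [disjoint A & B]%fset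
  then (-1) ^+ (\sum_(a <- A) \sum_(b <- B) letter_lt b a)%N else 0.

Definition sone (R : comNzRingType) : superseries R :=
  Superseries (fun m => (m == smonom1)%:R).

HB.lock Definition smul (R : comNzRingType) (f g : superseries R) :
    superseries R :=
  Superseries (fun m =>
    \sum_(p \in [set p : smonom * smonom | smonomM p.1 p.2 = m])
      ssign R p.1.2 p.2.2 * (f p.1 * g p.2)).

Section SuperseriesRing.
Variable R : comNzRingType.
Implicit Types (A B C : {fset letter}) (u v w m : smonom).
Implicit Types (f g h : superseries R).

Local Notation sgn := (ssign R).
Local Notation sone := (sone R).
Local Notation smul := (@smul R).

Lemma superseriesP f g : (forall m, f m = g m) -> f = g.
Proof. by case: f g => [f] [g] /= fg; congr Superseries; apply/funext. Qed.

Definition szero := Superseries (fun _ => 0 : R).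
Definition sopp f := Superseries (fun m => - f m).
Definition sadd f g := Superseries (fun m => f m + g m).

Fact saddA : associative sadd.
Proof. by move=> f g h; apply: superseriesP => m; exact: addrA. Qed.
Fact saddC : commutative sadd.
Proof. by move=> f g; apply: superseriesP => m; exact: addrC. Qed.
Fact sadd0r : left_id szero sadd.
Proof. by move=> f; apply: superseriesP => m; exact: add0r. Qed.
Fact saddNr : left_inverse szero sopp sadd.
Proof. by move=> f; apply: superseriesP => m; exact: addNr. Qed.

HB.instance Definition _ := GRing.isZmodule.Build (superseries R)
  saddA saddC sadd0r saddNr.

Lemma smonomMA : associative smonomM.
Proof. by move=> u v w; rewrite /smonomM /= msetDA fsetUA. Qed.

Lemma smonomMC : commutative smonomM.
Proof. by move=> u v; rewrite /smonomM msetDC fsetUC. Qed.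

Lemma smonom1M : left_id smonom1 smonomM.
Proof. by case=> e S; rewrite /smonomM /= mset0D fset0U. Qed.

Lemma smonomM1 : right_id smonom1 smonomM.
Proof. by move=> u; rewrite smonomMC smonom1M. Qed.

Lemma smonomM_eq1 u v : smonomM u v = smonom1 -> u = smonom1 /\ v = smonom1.
Proof.
have H u' v' : smonomM u' v' = smonom1 -> u' = smonom1.
  case: u' v' => [e S] [e' S'] [/msetP he hS]; congr pair.
    apply/msetP => a; move: (he a); rewrite msetE2 mset0E.
    by move/eqP; rewrite addn_eq0 => /andP[/eqP].
  by apply/eqP; rewrite -fsubset0 -hS fsubsetUl.
by move=> huv; split; [exact: H huv | apply: (H v u); rewrite smonomMC].
Qed.

Lemma finite_msubset (e : {mset letter}) :
  finite_set [set e' : {mset letter} | msubset e' e].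
Proof.
pose T := (size e).-tuple bool.
apply: (@sub_finite_set _ _
  ((fun b : T => seq_mset (mask b e)) @` [set: T])); last first.
  by apply: finite_image; exact: finite_finset.
move=> e' /= /msubsetP he.
have /count_subseqP[s /subseqP[b sb ->] pe] :
    forall a, (count_mem a e' <= count_mem a e)%N.
  by move=> a; rewrite !count_mem_mset.
exists (tcast sb (in_tuple b)) => //=.
rewrite val_tcast /= -[RHS]seq_mset_id; apply/eq_seq_msetP.
by rewrite perm_sym.
Qed.

Lemma finite_factors m :
  finite_set [set p : smonom * smonom | smonomM p.1 p.2 = m].
Proof.
pose D : set smonom :=
  ([set e' : {mset letter} | msubset e' m.1] `*` [set` fpowerset m.2])%classic.
have fD : finite_set D.
  by apply: finite_setX; [exact: finite_msubset | exact: finite_fset].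
apply: (@sub_finite_set _ _ (D `*` D)%classic); last exact: finite_setX.
have H u v : smonomM u v = m -> D u.
  rewrite /D => <-; split => /=.
    by apply/msubsetP => a; rewrite msetE2 leq_addr.
  by rewrite fpowersetE fsubsetUl.
move=> [u v] /= uv; split; first exact: H uv.
by apply: (H v u); rewrite smonomMC.
Qed.

Definition factors m : {fset smonom * smonom} :=
  fset_set [set p : smonom * smonom | smonomM p.1 p.2 = m].

Lemma factorsP m p : reflect (smonomM p.1 p.2 = m) (p \in factors m).
Proof.
rewrite in_fset_set; last exact: finite_factors.
by apply: (iffP idP); rewrite inE.
Qed.

Lemma smulE f g m :
  smul f g m =
  \sum_(p <- factors m) sgn p.1.2 p.2.2 * (f p.1 * g p.2).
Proof. by rewrite unlock /= fsbig_finite //; exact: finite_factors. Qed.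

Lemma factors3 (G : smonom -> smonom -> smonom -> R) m :
  \sum_(p <- factors m) \sum_(q <- factors p.2) G p.1 q.1 q.2 =
  \sum_(p <- factors m) \sum_(q <- factors p.1) G q.1 q.2 p.2.
Proof.
pose F (r : smonom * smonom * smonom) := G r.1.1 r.1.2 r.2.
rewrite -(big_allpairs_dep (h := fun p q : smonom * smonom => (p.1, q.1, q.2))
  (r2 := fun p => enum_fset (factors p.2)) (F := F)).
rewrite -(big_allpairs_dep (h := fun p q : smonom * smonom => (q.1, q.2, p.2))
  (r2 := fun p => enum_fset (factors p.1)) (F := F)).
apply: perm_big; apply: uniq_perm.
- apply: allpairs_uniq_dep => [|p _|]; rewrite ?fset_uniq //=.
  move=> r r' /allpairsPdep[p [q [_ /factorsP hq ->]]].
  move=> /allpairsPdep[p' [q' [_ /factorsP hq' ->]]] /= [h1 h2 h3].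
  have eq : q = q' by case: q q' h2 h3 {hq hq'} => ? ? [? ?] /= -> ->.
  have -> : p = p' by case: p p' h1 hq hq' => ? ? [? ?] /= -> <- <-; rewrite eq.
  by rewrite eq.
- apply: allpairs_uniq_dep => [|p _|]; rewrite ?fset_uniq //=.
  move=> r r' /allpairsPdep[p [q [_ /factorsP hq ->]]].
  move=> /allpairsPdep[p' [q' [_ /factorsP hq' ->]]] /= [h1 h2 h3].
  have eq : q = q' by case: q q' h1 h2 {hq hq'} => ? ? [? ?] /= -> ->.
  have -> : p = p' by case: p p' h3 hq hq' => ? ? [? ?] /= -> <- <-; rewrite eq.
  by rewrite eq.
move=> [[u v] w]; apply/allpairsPdep/allpairsPdep => /=.
  move=> [p [q [/factorsP hp /factorsP hq [-> -> ->]]]].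
  exists (smonomM p.1 q.1, q.2), (p.1, q.1); split => //; apply/factorsP => //=.
  by rewrite -smonomMA hq.
move=> [p [q [/factorsP hp /factorsP hq [-> -> ->]]]].
exists (q.1, smonomM q.2 p.2), (q.2, p.2); split => //; apply/factorsP => //=.
by rewrite smonomMA hq.
Qed.

Lemma big_fsetU_disjoint A B (F : letter -> nat) : [disjoint A & B]%fset ->
  (\sum_(a <- (A `|` B)%fset) F a = \sum_(a <- A) F a + \sum_(a <- B) F a)%N.
Proof.
move=> dAB; rewrite -big_cat /=; apply: perm_big; apply: uniq_perm; first exact: fset_uniq.
  rewrite cat_uniq !fset_uniq /= andbT; apply/hasPn => b bB /=.
  by apply/negP => bA; move/fdisjointP: dAB => /(_ _ bA); rewrite bB.
by move=> a; rewrite in_fsetU mem_cat.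
Qed.

Lemma ssignA A B C :
  sgn A (B `|` C)%fset * sgn B C = sgn A B * sgn (A `|` B)%fset C.
Proof.
rewrite /ssign fdisjointXU fdisjointUX.
case: ifPn => [/andP[dAB dAC]|]; last first.
  rewrite mul0r; have [dAB|] := boolP [disjoint A & B]%fset; last by rewrite mul0r.
  by rewrite /= => /negbTE->; rewrite mulr0.
rewrite dAB dAC /=; have [dBC|] := boolP [disjoint B & C]%fset; last by rewrite !mulr0.
rewrite -!exprD big_fsetU_disjoint //; congr (_ ^+ _).
rewrite addnA -big_split /=; congr addn.
by apply: eq_bigr => a _; rewrite big_fsetU_disjoint.
Qed.

Lemma ssign0A A : sgn fset0 A = 1.
Proof. by rewrite /ssign fdisjoint0X big_seq_fset0. Qed.

Lemma ssignA0 A : sgn A fset0 = 1.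
Proof.
rewrite /ssign fdisjointX0 big1 ?expr0 // => a _.
by rewrite big_seq_fset0.
Qed.

Lemma smulA : associative smul.
Proof.
move=> f g h; apply: superseriesP => m; rewrite !smulE.
under eq_bigr => p _ do rewrite smulE 2!mulr_sumr.
rewrite [RHS](eq_bigr (fun p => \sum_(q <- factors p.1)
  sgn p.1.2 p.2.2 * (sgn q.1.2 q.2.2 * (f q.1 * g q.2) * h p.2))); last first.
  by move=> p _; rewrite smulE mulr_suml mulr_sumr.
pose G u v w := sgn u.2 v.2 * sgn (u.2 `|` v.2)%fset w.2 * (f u * g v * h w).
rewrite [LHS](eq_bigr (fun p => \sum_(q <- factors p.2) G p.1 q.1 q.2)).
  rewrite factors3; apply: eq_bigr => p _.
  rewrite big_seq [RHS]big_seq; apply: eq_bigr => q /factorsP hq.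
  by rewrite /G -hq /= mulrA [sgn _ _ * sgn _ _]mulrC -!mulrA.
move=> p _; rewrite big_seq [RHS]big_seq; apply: eq_bigr => q /factorsP hq.
rewrite /G -ssignA -hq /= -!mulrA; congr (_ * _).
by rewrite [f _ * _]mulrCA.
Qed.

Lemma smul1r : left_id sone smul.
Proof.
move=> f; apply: superseriesP => m; rewrite smulE.
have hm : (smonom1, m) \in factors m by apply/factorsP; rewrite smonom1M.
rewrite (big_fsetD1 _ hm) /= big_seq big1 ?addr0.
  by rewrite ssign0A eqxx !mul1r.
move=> [u v]; rewrite in_fsetD1 => /andP[ne /factorsP /= uv].
rewrite /=; have [u1|] := eqVneq u smonom1; last by rewrite mul0r mulr0.
by move: uv ne; rewrite u1 smonom1M => ->; rewrite eqxx.
Qed.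

Lemma smulr1 : right_id sone smul.
Proof.
move=> f; apply: superseriesP => m; rewrite smulE.
have hm : (m, smonom1) \in factors m by apply/factorsP; rewrite smonomM1.
rewrite (big_fsetD1 _ hm) /= big_seq big1 ?addr0.
  by rewrite ssignA0 eqxx mul1r mulr1.
move=> [u v]; rewrite in_fsetD1 => /andP[ne /factorsP /= uv].
rewrite /=; have [v1|] := eqVneq v smonom1; last by rewrite !mulr0.
by move: uv ne; rewrite v1 smonomM1 => ->; rewrite eqxx.
Qed.

Lemma addsE f g m : (f + g) m = f m + g m.
Proof. by []. Qed.

Lemma oppsE f m : (- f) m = - f m.
Proof. by []. Qed.

Lemma smulDl : left_distributive smul +%R.
Proof.
move=> f g h; apply: superseriesP => m; rewrite [RHS]addsE !smulE -big_split /=.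
by apply: eq_bigr => p _; rewrite -mulrDr -mulrDl.
Qed.

Lemma smulDr : right_distributive smul +%R.
Proof.
move=> f g h; apply: superseriesP => m; rewrite [RHS]addsE !smulE -big_split /=.
by apply: eq_bigr => p _; rewrite -!mulrDr.
Qed.

Lemma sone_neq0 : sone != 0.
Proof.
apply/eqP => /(congr1 (fun f => f smonom1)); rewrite /= eqxx => /eqP.
by rewrite oner_eq0.
Qed.

HB.instance Definition _ := GRing.Zmodule_isNzRing.Build (superseries R)
  smulA smul1r smulr1 smulDl smulDr sone_neq0.

Definition is_sinv f g : Prop := g * f = 1 /\ f * g = 1.
Definition sunit : pred (superseries R) := fun f => `[< exists g, is_sinv f g >].
Definition sinv f : superseries R := xget f (is_sinv f).

Lemma sinvP f : f \in sunit -> is_sinv f (sinv f).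
Proof. by move=> /asboolP; exact: xgetPex. Qed.

Fact smulVr : {in sunit, left_inverse 1 sinv *%R}.
Proof. by move=> f /sinvP[]. Qed.

Fact smulrV : {in sunit, right_inverse 1 sinv *%R}.
Proof. by move=> f /sinvP[]. Qed.

Fact sunitP f g : is_sinv f g -> sunit f.
Proof. by move=> fg; apply/asboolP; exists g. Qed.

Fact sinv_out : {in [predC sunit], sinv =1 id}.
Proof.
move=> f; rewrite inE => /asboolPn nf.
by rewrite /sinv xgetPN // => g fg; apply: nf; exists g.
Qed.

HB.instance Definition _ := GRing.NzRing_hasMulInverse.Build (superseries R)
  smulVr smulrV sunitP sinv_out.

End SuperseriesRing.

Section Families.
Variable R : comNzRingType.
Implicit Type (m : smonom).

(* Convergence of unordered infinite sums and products, coefficient by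
   coefficient. The finite partial products may be taken in any order. *)
Definition has_sum (I : eqType) (D : set I) (F : I -> superseries R)
    (S : superseries R) : Prop :=
  forall m, exists2 s0 : seq I, {in s0, forall i, D i} &
    forall s : seq I, uniq s -> {in s, forall i, D i} -> {subset s0 <= s} ->
      (\sum_(i <- s) F i) m = S m.

Definition has_prod (I : eqType) (F : I -> superseries R)
    (P : superseries R) : Prop :=
  forall m, exists s0 : seq I,
    forall s : seq I, uniq s -> {subset s0 <= s} ->
      (\prod_(i <- s) F i) m = P m.

Definition summable (I : eqType) (D : set I) (F : I -> superseries R) : Prop :=
  exists S, has_sum D F S.

Definition multipliable (I : eqType) (F : I -> superseries R) : Prop :=
  exists P, has_prod F P.

(* Meaningful for summable, respectively multipliable, families only. *)
Definition infsum (I : eqType) (D : set I) (F : I -> superseries R) :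
  superseries R := xget 0 (has_sum D F).

Definition infprod (I : eqType) (F : I -> superseries R) : superseries R :=
  xget 1 (has_prod F).

Lemma has_sum_unique (I : eqType) (D : set I) (F : I -> superseries R) S S' :
  has_sum D F S -> has_sum D F S' -> S = S'.
Proof.
move=> hS hS'; apply: superseriesP => m.
have [s0 D0 /(_ (undup (s0 ++ _))) h0] := hS m.
have [s1 D1 /(_ (undup (s0 ++ s1))) h1] := hS' m.
have Ds : {in undup (s0 ++ s1), forall i, D i}.
  by move=> i; rewrite mem_undup mem_cat => /orP[/D0|/D1].
rewrite -(h0 s1) ?h1 ?undup_uniq //.
  by move=> i; rewrite mem_undup mem_cat orbC => ->.
by move=> i; rewrite mem_undup mem_cat => ->.
Qed.

Lemma has_prod_unique (I : eqType) (F : I -> superseries R) P P' :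
  has_prod F P -> has_prod F P' -> P = P'.
Proof.
move=> hP hP'; apply: superseriesP => m.
have [s0 h0] := hP m; have [s1 h1] := hP' m.
rewrite -(h0 (undup (s0 ++ s1))) -?(h1 (undup (s0 ++ s1))) ?undup_uniq //.
  by move=> i; rewrite mem_undup mem_cat orbC => ->.
by move=> i; rewrite mem_undup mem_cat => ->.
Qed.

End Families.

Definition sterm (R : comNzRingType) (u : smonom) : superseries R :=
  Superseries (fun m => (m == u)%:R).
HB.lock Definition evar (R : comNzRingType) (a : letter) : superseries R :=
  sterm R ([mset a], fset0).
HB.lock Definition ovar (R : comNzRingType) (a : letter) : superseries R :=
  sterm R (mset0, [fset a]).

Section Monomials.
Variable R : comNzRingType.
Implicit Types (u v m : smonom) (a b : letter).

Local Notation sterm := (sterm R).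
Local Notation evar := (evar R).
Local Notation ovar := (ovar R).

Lemma smulrE (f g : superseries R) m :
  (f * g) m = \sum_(p <- factors m) ssign R p.1.2 p.2.2 * (f p.1 * g p.2).
Proof. exact: smulE. Qed.

Lemma sterm_mul u v m :
  (sterm u * sterm v) m = ssign R u.2 v.2 * (m == smonomM u v)%:R.
Proof.
rewrite smulrE; have [mE|mE] := eqVneq m (smonomM u v).
  have hm : (u, v) \in factors m by apply/factorsP.
  rewrite (big_fsetD1 _ hm) /= big_seq big1 ?addr0 /= ?eqxx ?mulr1 //.
  move=> [u' v']; rewrite in_fsetD1 xpair_eqE => /andP[ne _] /=.
  by move: ne; case: (u' == u); case: (v' == v); rewrite ?mul0r ?mulr0.
rewrite mulr0 big_seq big1 // => -[u' v'] /factorsP /= hm.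
rewrite /=; have [uE|] := eqVneq u' u; last by rewrite mul0r mulr0.
have [vE|] := eqVneq v' v; last by rewrite !mulr0.
by rewrite -hm uE vE eqxx in mE.
Qed.

Lemma sterm_even_mull (e : {mset letter}) (g : superseries R) m :
  (sterm (e, fset0) * g) m =
  if msubset e m.1 then g (m.1 `\` e, m.2)%mset else 0.
Proof.
rewrite smulrE; case: ifPn => [em|/negP em]; last first.
  rewrite big_seq big1 // => -[u v] /factorsP /= hm.
  have [uE|] := eqVneq u (e, fset0); last by rewrite mul0r mulr0.
  case: em; rewrite -hm uE /=; apply/msubsetP => a.
  by rewrite msetE2 leq_addr.
have hm : ((e, fset0), (m.1 `\` e, m.2)%mset) \in factors m.
  by apply/factorsP; rewrite /smonomM /= msetBDKC // fset0U; case: (m).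
rewrite (big_fsetD1 _ hm) /= big_seq big1 ?addr0 /=.
  by rewrite ssign0A eqxx !mul1r.
move=> [u v]; rewrite in_fsetD1 => /andP[ne /factorsP /= uv].
have [uE|] := eqVneq u (e, fset0); last by rewrite mul0r mulr0.
case/eqP: ne; rewrite -uv uE; congr pair; rewrite /smonomM /=.
by rewrite msetDKB fset0U; case: (v).
Qed.

Lemma sterm_odd_mull a (g : superseries R) m :
  (sterm (mset0, [fset a]) * g) m =
  if a \in m.2 then ssign R [fset a] (m.2 `\ a)%fset * g (m.1, (m.2 `\ a)%fset)
  else 0.
Proof.
rewrite smulrE; case: ifPn => [am|/negP am]; last first.
  rewrite big_seq big1 // => -[u v] /factorsP /= hm.
  have [uE|] := eqVneq u (mset0, [fset a]); last by rewrite mul0r mulr0.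
  by case: am; rewrite -hm uE /= !inE eqxx.
have hm : ((mset0, [fset a]), (m.1, (m.2 `\ a)%fset)) \in factors m.
  by apply/factorsP; rewrite /smonomM /= mset0D fsetD1K //; case: (m) am.
rewrite (big_fsetD1 _ hm) /= big_seq big1 ?addr0 /=.
  by rewrite eqxx mul1r.
move=> [u v]; rewrite in_fsetD1 => /andP[ne /factorsP /= uv].
have [uE|] := eqVneq u (mset0, [fset a]); last by rewrite mul0r mulr0.
have [av|av] := boolP (a \in v.2).
  by rewrite uE /= /ssign fdisjoint1X av mul0r.
case/eqP: ne; rewrite -uv uE; congr pair; rewrite /smonomM /=.
by rewrite mset0D fsetU1K //; case: (v).
Qed.

Lemma evarX a n : evar a ^+ n = sterm (msetn n a, fset0).
Proof.
elim: n => [|n IHn]; apply: superseriesP => m; first by rewrite expr0 msetn0.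
rewrite exprS IHn unlock sterm_mul ssign0A mul1r /= /smonomM /= fset0U.
congr (_ == (_, _))%:R.
by apply/msetP => b; rewrite msetE2 !msetnE; case: eqP.
Qed.

Lemma evar_comm a b : evar a * evar b = evar b * evar a.
Proof.
apply: superseriesP => m; rewrite unlock [LHS]sterm_mul [RHS]sterm_mul.
by rewrite smonomMC !ssign0A.
Qed.

Lemma evar_ovar_comm a b : evar a * ovar b = ovar b * evar a.
Proof.
apply: superseriesP => m; rewrite !unlock [LHS]sterm_mul [RHS]sterm_mul.
by rewrite smonomMC ssign0A ssignA0.
Qed.

Lemma ovar_sqr a : ovar a * ovar a = 0.
Proof.
apply: superseriesP => m; rewrite unlock sterm_mul /ssign /= fdisjointX1 inE eqxx /=.
by rewrite mul0r.
Qed.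

Lemma ovar_anticomm a b : ovar a * ovar b = - (ovar b * ovar a).
Proof.
have [->|ab] := eqVneq a b; first by rewrite ovar_sqr oppr0.
apply: superseriesP => m; rewrite unlock [LHS]sterm_mul oppsE.
rewrite [X in - X]sterm_mul /=.
rewrite smonomMC -mulNr; congr (_ * _).
rewrite /ssign !fdisjointX1 !inE ab eq_sym ab !big_seq_fset1 /letter_lt /=.
case: a b ab => [i j] [k l]; rewrite xpair_eqE /=.
by case: (ltngtP i k) => //; case: (ltngtP j l) => //; rewrite ?opprK.
Qed.

End Monomials.

Section Variables.
Variable R : comNzRingType.

Definition tvar : superseries R := evar R (0, 0)%N.
Definition tauvar : superseries R := ovar R (0, 0)%N.
Definition xvar (i : nat) : superseries R := evar R (1, i)%N.
Definition thetavar (i : nat) : superseries R := ovar R (1, i)%N.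
Definition yvar (j : nat) : superseries R := evar R (2, j)%N.
Definition phivar (j : nat) : superseries R := ovar R (2, j)%N.

End Variables.

(* The trailing zeros of the second component are dropped. *)
Record superpartition := SuperPartition {
  spart :> seq nat * seq nat;
  _ : [&& sorted gtn spart.1, sorted geq spart.2 & 0%N \notin spart.2] }.

HB.instance Definition _ := [isSub for spart].
HB.instance Definition _ := [Countable of superpartition by <:].

Definition fermionic (L : superpartition) : seq nat := (spart L).1.
Definition bosonic (L : superpartition) : seq nat := (spart L).2.
Definition slength (L : superpartition) : nat :=
  size (fermionic L) + size (bosonic L).
Definition sentry (L : superpartition) (i : nat) : nat :=
  nth 0%N (fermionic L ++ bosonic L) i.

Section SuperSymmetric.
Variable R : comNzRingType.
Implicit Types (x theta : nat -> superseries R) (L : superpartition).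

Definition smonomial_term x theta L (s : nat -> nat) : superseries R :=
  (\prod_(i < size (fermionic L)) theta (s i)) *
  \prod_(i < slength L) x (s i) ^+ sentry L i.

(* The index of the sum is the term itself, so that a term obtained from
   several permutations is counted once. *)
Definition smonomial x theta L : superseries R :=
  infsum [set u | exists2 s : nat -> nat, bijective s &
                    u = smonomial_term x theta L s] id.

Definition overleftarrow (m : nat) (f : superseries R) : superseries R :=
  (-1) ^+ (m * m.-1)./2 * f.

(* The coefficient of t^n (b = false) or of t^n tau, tau being written on the
   left (b = true), as a series without t and tau. No sign appears in the
   latter case because (0, 0) is the smallest letter. *)
Definition ttau_coef (n : nat) (b : bool) (f : superseries R) : superseries R :=
  Superseries (fun m =>
    if ((0, 0)%N \in m.1) || ((0, 0)%N \in m.2) then 0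
    else f (msetn n (0, 0)%N `+` m.1,
            if b then ((0, 0)%N |` m.2)%fset else m.2)).

Lemma ttau_coef_has_sum (f : superseries R) :
  has_sum [set: nat] (fun n => tvar R ^+ n *
    (ttau_coef n false f + tauvar R * ttau_coef n true f)) f.
Proof.
move=> m; set o := (0, 0)%N : letter; exists [:: m.1 o] => // s us _ sk.
have scE (F : nat -> superseries R) (r : seq nat) :
    (\sum_(n <- r) F n) m = \sum_(n <- r) F n m.
  by elim: r => [|n r IHr]; rewrite ?big_nil // !big_cons addsE IHr.
have ks : m.1 o \in s by apply: sk; rewrite inE.
rewrite scE (bigD1_seq _ ks us) /= big1 ?addr0 => [|n nk].
  rewrite /tvar evarX sterm_even_mull ifT; last first.
    apply/msubsetP => a; rewrite msetnE -/o; case: eqP => // ->.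
    by rewrite leqnn.
  have o1 : o \notin (m.1 `\` msetn (m.1 o) o)%mset.
    by rewrite in_msetB msetnxx ltnn.
  have mE : (msetn (m.1 o) o `+` (m.1 `\` msetn (m.1 o) o))%mset = m.1.
    by rewrite msetBDKC //; apply/msubsetP => a; rewrite msetnE; case: eqP => // ->.
  rewrite addsE /tauvar unlock sterm_odd_mull /= -/o (negbTE o1) /=.
  have [om|om] := boolP (o \in m.2); last by rewrite addr0 mE; case: (m).
  rewrite !inE eqxx /= add0r mE fsetD1K // /ssign fdisjoint1X !inE eqxx /=.
  rewrite big_seq_fset1 big1 ?expr0 ?mul1r => [|[i j] _]; first by case: (m) om.
  by rewrite /letter_lt /= !ltn0 andbF.
rewrite /tvar evarX sterm_even_mull; case: ifPn => // /msubsetP /(_ o).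
rewrite msetnxx => nm; have o1 : o \in (m.1 `\` msetn n o)%mset.
  by rewrite in_msetB msetnxx ltn_neqAle nk.
rewrite addsE /tauvar unlock sterm_odd_mull /= -/o o1 /= add0r mulr0.
by case: ifP.
Qed.

Definition hgen x theta : superseries R :=
  infprod (fun i : nat => (1 - tvar R * x i - tauvar R * theta i)^-1).

Definition hfun x theta (n : nat) : superseries R :=
  ttau_coef n false (hgen x theta).
Definition hfun_tilde x theta (n : nat) : superseries R :=
  ttau_coef n true (hgen x theta).

Definition hsuper x theta L : superseries R :=
  (\prod_(i < size (fermionic L)) hfun_tilde x theta (sentry L i)) *
  \prod_(size (fermionic L) <= i < slength L) hfun x theta (sentry L i).

End SuperSymmetric.

(* Main.v *)
Require Import Defs.
From mathcomp Require Import all_boot all_order all_algebra.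
From mathcomp Require Import finmap multiset.
From mathcomp Require Import boolp classical_sets.

(** For fixed [i], the product over [j] of the factors of [K] is the generating
    function of the complete functions at [(t, tau) = (x_i, theta_i)], that is
    [\sum_n x_i ^ n (h_n + theta_i ht_n)]. Expanding the product over [i], a term
    chooses for each [i] an exponent and whether [theta_i] occurs. All the factors
    are even, so they can be sorted by decreasing exponent, fermionic ones first:
    a repeated fermionic exponent gives [0] because [ht_n ^ 2 = 0], and otherwise
    separating the [theta]s from the [ht]s gives the sign [(-1) ^ (m (m - 1) / 2)]
    and the product of a term of [m_Lambda] with [h_Lambda].

    Infinite sums and products are made finite by working, for each monomial [m],
    modulo the two-sided ideal of series without monomials dividing [m]. *)

Set Implicit Arguments.
Unset Strict Implicit.
Unset Printing Implicit Defensive.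

Import GRing.Theory.

Local Open Scope ring_scope.

(** The ring of series is not commutative: the head of [s1] is located in [s2] and brought to the
    front past factors that commute with it. *)
Lemma perm_big_comm (A : pzRingType) (I : eqType) (F : I -> A) (s1 s2 : seq I) :
  (forall i j, GRing.comm (F i) (F j)) -> perm_eq s1 s2 ->
  \prod_(i <- s1) F i = \prod_(i <- s2) F i.
Proof.
move=> cF; elim: s1 s2 => [|i s1 IH] s2; first by rewrite perm_sym => /perm_nilP ->.
move=> p12; have i2 : i \in s2 by rewrite -(perm_mem p12) mem_head.
have /perm_trans/(_ (perm_to_rem i2)) := p12; rewrite perm_cons => /IH p.
rewrite big_cons p {p12 p}.
elim: s2 i2 => //= j s2 IHs; rewrite inE [X in _ = X]big_cons eq_sym.
case: eqVneq => [->//|ji /= /IHs <-].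
by rewrite big_cons !mulrA cF.
Qed.

(** * Congruence modulo a monomial; infinite sums and products *)

Section Congruence.
Variable R : comNzRingType.
Implicit Types (f g h : superseries R) (m u v : smonom) (a b : letter).

(** Asking for agreement at every divisor [u] of [m], not at [m] alone, makes this compatible with
    products: a coefficient of a product at [u] only involves coefficients at divisors of [u]. *)
Definition eqmod m f g : Prop := forall u v, smonomM u v = m -> f u = g u.

Lemma eqmod_refl m f : eqmod m f f. Proof. by []. Qed.

Lemma eqmod_sym m f g : eqmod m f g -> eqmod m g f.
Proof. by move=> fg u v /fg. Qed.

Lemma eqmod_trans m g f h : eqmod m f g -> eqmod m g h -> eqmod m f h.
Proof. by move=> fg gh u v uv; rewrite (fg u v) // (gh u v). Qed.

Lemma eqmod_coef m f g : eqmod m f g -> f m = g m.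
Proof. by move/(_ m smonom1); apply; rewrite smonomM1. Qed.

Lemma eqmod_all f g : (forall m, eqmod m f g) -> f = g.
Proof. by move=> fg; apply: superseriesP => m; apply: eqmod_coef. Qed.

Lemma eqmod_dvd m u v f g : smonomM u v = m -> eqmod m f g -> eqmod u f g.
Proof.
move=> uv fg u1 v1 u1E; apply: (fg _ (smonomM v1 v)).
by rewrite smonomMA u1E.
Qed.

Lemma eqmodD m f f' g g' :
  eqmod m f f' -> eqmod m g g' -> eqmod m (f + g) (f' + g').
Proof. by move=> ff gg u v uv; rewrite !addsE (ff u v) // (gg u v). Qed.

Lemma eqmodN m f f' : eqmod m f f' -> eqmod m (- f) (- f').
Proof. by move=> ff u v uv; rewrite !oppsE (ff u v). Qed.

Lemma eqmodB m f f' g g' :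
  eqmod m f f' -> eqmod m g g' -> eqmod m (f - g) (f' - g').
Proof. by move=> ff /eqmodN; apply: eqmodD. Qed.

Lemma eqmodM m f f' g g' :
  eqmod m f f' -> eqmod m g g' -> eqmod m (f * g) (f' * g').
Proof.
move=> ff gg u v uv; rewrite !smulrE big_seq [RHS]big_seq.
apply: eq_bigr => -[p q] /factorsP /= pq.
rewrite (ff p (smonomM q v)) ?smonomMA ?pq //.
by rewrite (gg q (smonomM p v)) // smonomMA [smonomM q p]smonomMC pq.
Qed.

Lemma eqmodMl0 m f g : eqmod m f 0 -> eqmod m (f * g) 0.
Proof. by move=> f0; rewrite -(mul0r g); apply: eqmodM. Qed.

Lemma eqmodMr0 m f g : eqmod m g 0 -> eqmod m (f * g) 0.
Proof. by move=> g0; rewrite -(mulr0 f); apply: eqmodM. Qed.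

Lemma eqmod_sum m (I : eqType) (s : seq I) (F G : I -> superseries R) :
  {in s, forall i, eqmod m (F i) (G i)} ->
  eqmod m (\sum_(i <- s) F i) (\sum_(i <- s) G i).
Proof.
elim: s => [|i s IH] FG; first by rewrite !big_nil.
rewrite !big_cons; apply: eqmodD; first by apply: FG; rewrite mem_head.
by apply: IH => j js; apply: FG; rewrite inE js orbT.
Qed.

Lemma eqmod_prod m (I : eqType) (s : seq I) (F G : I -> superseries R) :
  {in s, forall i, eqmod m (F i) (G i)} ->
  eqmod m (\prod_(i <- s) F i) (\prod_(i <- s) G i).
Proof.
elim: s => [|i s IH] FG; first by rewrite !big_nil.
rewrite !big_cons; apply: eqmodM; first by apply: FG; rewrite mem_head.
by apply: IH => j js; apply: FG; rewrite inE js orbT.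
Qed.

Lemma eqmod_sum0 m (I : eqType) (s : seq I) (F : I -> superseries R) :
  {in s, forall i, eqmod m (F i) 0} -> eqmod m (\sum_(i <- s) F i) 0.
Proof. by move=> /(@eqmod_sum m I s F (fun=> 0)); rewrite big1_eq. Qed.

Lemma eqmod_prod1 m (I : eqType) (s : seq I) (F : I -> superseries R) :
  {in s, forall i, eqmod m (F i) 1} -> eqmod m (\prod_(i <- s) F i) 1.
Proof. by move=> /(@eqmod_prod m I s F (fun=> 1)); rewrite big1_eq. Qed.

Lemma eqmod_sum_widen m (I : eqType) (A : set I) (s s' : seq I)
    (F : I -> superseries R) :
  uniq s -> uniq s' -> {in s', forall i, A i} -> {subset s <= s'} ->
  (forall i, A i -> i \notin s -> eqmod m (F i) 0) ->
  eqmod m (\sum_(i <- s') F i) (\sum_(i <- s) F i).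
Proof.
move=> us us' As' ss' F0; rewrite (bigID (mem s)) /= -big_filter.
rewrite (perm_big s) /=; last first.
  apply: uniq_perm; rewrite ?filter_uniq // => i; rewrite mem_filter.
  by apply/andP/idP => [[]//|i_s]; rewrite ss'.
rewrite -[X in eqmod _ _ X]addr0; apply: eqmodD => //.
rewrite -big_filter.
by apply: eqmod_sum0 => i; rewrite mem_filter => /andP[ni /As' Ai]; apply: F0.
Qed.

Definition sum_support m (I : eqType) (A : set I) (F : I -> superseries R)
    (s : seq I) : Prop :=
  [/\ uniq s, {in s, forall i, A i}
    & forall i, A i -> i \notin s -> eqmod m (F i) 0].

Lemma sum_support_eqmod m (I : eqType) (A : set I) (F : I -> superseries R) s s' :
  sum_support m A F s -> sum_support m A F s' ->
  eqmod m (\sum_(i <- s) F i) (\sum_(i <- s') F i).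
Proof.
move=> [us As F0] [us' As' F0']; pose t := undup (s ++ s').
have At : {in t, forall i, A i}.
  by move=> i; rewrite mem_undup mem_cat => /orP[/As|/As'].
apply: (@eqmod_trans _ (\sum_(i <- t) F i)); [apply: eqmod_sym|];
apply: (eqmod_sum_widen _ _ At) => //; rewrite ?undup_uniq //.
  by move=> i i_s; rewrite mem_undup mem_cat i_s.
by move=> i i_s; rewrite mem_undup mem_cat i_s orbT.
Qed.

Lemma sum_support_dvd m u v (I : eqType) (A : set I) (F : I -> superseries R) s :
  smonomM u v = m -> sum_support m A F s -> sum_support u A F s.
Proof.
by move=> uv [us As F0]; split=> // i Ai /(F0 i Ai); apply: eqmod_dvd uv.
Qed.

(** The coefficient of the limit at [m] is read off a support chosen for [m]. A support for [m] also
    serves for every divisor of [m], and any two supports give congruent sums, so these choices fit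
    together. *)
Lemma infsum_eqmod (I : eqType) (A : set I) (F : I -> superseries R) :
  (forall m, exists s, sum_support m A F s) ->
  summable A F /\ forall m s, sum_support m A F s ->
    eqmod m (infsum A F) (\sum_(i <- s) F i).
Proof.
move=> /choice[s_ sP].
pose S := Superseries (fun m => (\sum_(i <- s_ m) F i) m).
have SE m s : sum_support m A F s -> eqmod m S (\sum_(i <- s) F i).
  move=> sF u v uv /=; apply: eqmod_coef.
  by apply: sum_support_eqmod => //; apply: sum_support_dvd uv sF.
have hS : has_sum A F S.
  move=> m; have [us As F0] := sP m; exists (s_ m) => // s us' As' ss'.
  by rewrite /=; apply: eqmod_coef; apply: (eqmod_sum_widen _ _ As').
have iS : infsum A F = S.
  by apply: (has_sum_unique _ hS); apply: xgetPex; exists S.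
by rewrite iS; split=> //; exists S.
Qed.

Lemma eqmod_prod_widen m (I : eqType) (s s' : seq I) (F : I -> superseries R) :
  (forall i j, GRing.comm (F i) (F j)) ->
  uniq s -> uniq s' -> {subset s <= s'} ->
  (forall i, i \notin s -> eqmod m (F i) 1) ->
  eqmod m (\prod_(i <- s') F i) (\prod_(i <- s) F i).
Proof.
move=> cF us us' ss' F1.
rewrite (@perm_big_comm _ _ _ _ (s ++ [seq i <- s' | i \notin s])) //; last first.
  apply: uniq_perm => //.
    rewrite cat_uniq us filter_uniq // andbT /=; apply/hasPn => i.
    by rewrite mem_filter => /andP[].
  move=> i; rewrite mem_cat mem_filter.
  by have [/ss' ->|] := boolP (i \in s).
rewrite big_cat /= -[X in eqmod _ _ X]mulr1; apply: eqmodM => //.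
by apply: eqmod_prod1 => i; rewrite mem_filter => /andP[ni _]; apply: F1.
Qed.

Definition prod_support m (I : eqType) (F : I -> superseries R)
    (s : seq I) : Prop :=
  uniq s /\ forall i, i \notin s -> eqmod m (F i) 1.

(** Same gluing as for sums. [has_prod] allows the indices in any order, which is why the factors
    are asked to commute. *)
Lemma infprod_eqmod (I : eqType) (F : I -> superseries R) :
  (forall i j, GRing.comm (F i) (F j)) ->
  (forall m, exists s, prod_support m F s) ->
  multipliable F /\ forall m s, prod_support m F s ->
    eqmod m (infprod F) (\prod_(i <- s) F i).
Proof.
move=> cF /choice[s_ sP].
pose P := Superseries (fun m => (\prod_(i <- s_ m) F i) m).
have PE m s : prod_support m F s -> eqmod m P (\prod_(i <- s) F i).
  move=> [us F1] u v uv /=; apply: eqmod_coef.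
  have [us' F1'] := sP u; pose t := undup (s ++ s_ u).
  apply: (@eqmod_trans _ (\prod_(i <- t) F i)); [apply: eqmod_sym|];
  apply: eqmod_prod_widen => //; rewrite ?undup_uniq //.
  - by move=> i i_s; rewrite mem_undup mem_cat i_s orbT.
  - by move=> i i_s; rewrite mem_undup mem_cat i_s.
  by move=> i /F1; apply: eqmod_dvd uv.
have hP : has_prod F P.
  move=> m; have [us F1] := sP m; exists (s_ m) => // s us' ss'.
  by rewrite /=; apply: eqmod_coef; apply: eqmod_prod_widen.
have iP : infprod F = P.
  by apply: (has_prod_unique _ hP); apply: xgetPex; exists P.
by rewrite iP; split=> //; exists P.
Qed.

(** The inverse is the geometric series, which is finite modulo each [m]: the powers beyond one that
    vanishes are multiples of it. *)
Lemma unitr_1sub f : (forall m, exists n, eqmod m (f ^+ n) 0) ->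
  1 - f \is a GRing.unit.
Proof.
move=> nf; have F0 m k : eqmod m (f ^+ k) 0 ->
    sum_support m [set: nat] (fun n => f ^+ n) (iota 0 k).
  move=> fk; split=> //; first exact: iota_uniq.
  move=> n _; rewrite mem_iota add0n -leqNgt => /subnKC <-.
  by rewrite exprD; apply: eqmodMl0.
have [|_ gE] := @infsum_eqmod nat [set: nat] (fun n => f ^+ n).
  by move=> m; have [n /F0 fn] := nf m; exists (iota 0 n).
set g := infsum _ _ in gE.
have gk m k : eqmod m (f ^+ k) 0 -> eqmod m g (\sum_(i < k) f ^+ i).
  by move=> /F0/gE; rewrite -[in iota 0 k](subn0 k) -/(index_iota 0 k) big_mkord.
have geo k : \sum_(i < k) f ^+ i * (1 - f) = 1 - f ^+ k.
  elim: k => [|k IH]; first by rewrite big_ord0 expr0 subrr.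
  by rewrite big_ord_recr /= IH exprSr mulrBr mulr1 addrA subrK.
apply/unitrP; exists g; split; apply: eqmod_all => m; have [k fk] := nf m.
  have := eqmodM (gk _ _ fk) (@eqmod_refl m (1 - f)).
  rewrite mulr_suml geo => /eqmod_trans; apply.
  by rewrite -[X in eqmod _ _ X]subr0; apply: eqmodB.
have := eqmodM (@eqmod_refl m (1 - f)) (gk _ _ fk).
(* The other one-sided inverse uses the factorization of [f ^+ k - 1] with [f - 1] on the left. *)
rewrite -[X in eqmod _ _ (X * _)]opprB mulNr -subrX1 opprB => /eqmod_trans; apply.
by rewrite -[X in eqmod _ _ X]subr0; apply: eqmodB.
Qed.

End Congruence.

(** * Parity in the anticommuting variables; the factors of the kernel *)

Section Parity.
Variable R : comNzRingType.
Implicit Types (f g h : superseries R) (m u v : smonom) (a b : letter).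

Definition has_parity (p : bool) f : Prop :=
  forall m, odd #|` m.2| != p -> f m = 0.

(** For disjoint [A] and [B], each pair is counted by exactly one of the two exponents, since
    [letter_lt] is total on distinct letters; so the exponents add up to the number of pairs. *)
Lemma ssignC (A B : {fset letter}) :
  ssign R A B = (-1) ^+ (#|` A| * #|` B|) * ssign R B A.
Proof.
rewrite /ssign fdisjoint_sym; case: ifPn => [dBA|]; last by rewrite mulr0.
rewrite -exprD [in RHS]exchange_big /=.
set s := (\sum_(a <- A) _)%N; set t := (\sum_(a <- A) _)%N.
suff -> : (#|` A| * #|` B| = t + s)%N.
  by rewrite addnAC addnn exprD -[X in _ = X * _]signr_odd odd_double mul1r.
rewrite /s /t -big_split /= -sum1_size big_distrl /=.
rewrite big_seq [RHS]big_seq; apply: eq_bigr => a aA.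
rewrite -big_split /= mul1n -sum1_size big_seq [RHS]big_seq.
apply: eq_bigr => b bB; have : a != b.
  by apply: contraTneq aA => ->; move/fdisjointP: dBA; apply.
case: a b {aA bB} => [i j] [k l]; rewrite xpair_eqE /letter_lt /=.
by case: (ltngtP i k) => //; case: (ltngtP j l).
Qed.

(** The sum runs over the same factorizations as for [f * g], so that the two products can be
    compared term by term. *)
Lemma smulC_coef f g m : (g * f) m = \sum_(p <- factors m)
  (-1) ^+ (#|` p.1.2| * #|` p.2.2|) * (ssign R p.1.2 p.2.2 * (f p.1 * g p.2)).
Proof.
rewrite smulrE (perm_big [seq (p.2, p.1) | p <- factors m]) /=.
  rewrite big_map; apply: eq_bigr => p _ /=.
  by rewrite ssignC mulnC [g _ * _]mulrC -mulrA.
apply: uniq_perm; first exact: fset_uniq.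
  by rewrite map_inj_uniq ?fset_uniq // => -[? ?] [? ?] [-> ->].
move=> [u v]; apply/idP/mapP => [/factorsP /= uv|[[u' v'] /factorsP /= uv [-> ->]]].
  by exists (v, u) => //; apply/factorsP; rewrite smonomMC.
by apply/factorsP; rewrite smonomMC.
Qed.

Lemma even_comm f g : has_parity false f -> GRing.comm f g.
Proof.
move=> ef; apply: superseriesP => m; rewrite [RHS]smulC_coef smulrE.
apply: eq_bigr => p _; have [|e] := boolP (odd #|` p.1.2|).
  by move=> o; rewrite ef ?o // mul0r !mulr0.
by rewrite -signr_odd oddM (negbTE e) mul1r.
Qed.

Lemma odd_anticomm f g : has_parity true f -> has_parity true g ->
  f * g = - (g * f).
Proof.
move=> of_ og; apply: superseriesP => m; rewrite oppsE (smulC_coef f) smulrE -sumrN.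
apply: eq_bigr => p _; have [o1|e] := boolP (odd #|` p.1.2|); last first.
  by rewrite of_ ?(negbTE e) // mul0r !mulr0 oppr0.
have [o2|e] := boolP (odd #|` p.2.2|); last first.
  by rewrite og ?(negbTE e) // !mulr0 oppr0.
by rewrite -signr_odd oddM o1 o2 expr1 mulN1r opprK.
Qed.

Lemma has_parityD p f g : has_parity p f -> has_parity p g -> has_parity p (f + g).
Proof. by move=> pf pg m mp; rewrite addsE pf // pg // addr0. Qed.

Lemma has_parityN p f : has_parity p f -> has_parity p (- f).
Proof. by move=> pf m mp; rewrite oppsE pf // oppr0. Qed.

Lemma has_parity0 p : has_parity p (0 : superseries R).
Proof. by []. Qed.

Lemma has_parity1 : has_parity false (1 : superseries R).
Proof. by move=> m; case: (eqVneq m smonom1) => [->|/negbTE n1]; rewrite /= ?cardfs0 // n1. Qed.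

Lemma has_parityM p q f g :
  has_parity p f -> has_parity q g -> has_parity (p (+) q) (f * g).
Proof.
move=> pf qg m mp; rewrite smulrE big_seq big1 // => -[u v] /factorsP /= uv.
rewrite /ssign; case: ifPn => [duv|]; last by rewrite mul0r.
have [up|/pf ->] := eqVneq (odd #|` u.2|) p; last by rewrite mul0r mulr0.
have [vq|/qg ->] := eqVneq (odd #|` v.2|) q; last by rewrite !mulr0.
by move: mp; rewrite -uv /= cardfsU (eqP duv) cardfs0 subn0 oddD up vq eqxx.
Qed.

Lemma evar_even a : has_parity false (evar R a).
Proof.
rewrite unlock => m; case: (eqVneq m ([mset a]%mset, fset0)) => [->|/negbTE n1];
by rewrite /= ?cardfs0 // n1.
Qed.

Lemma ovar_odd a : has_parity true (ovar R a).
Proof.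
rewrite unlock => m; case: (eqVneq m (mset0, [fset a]%fset)) => [->|/negbTE n1];
by rewrite /= ?cardfs1 // n1.
Qed.

Lemma evar_central a f : GRing.comm (evar R a) f.
Proof. exact/even_comm/evar_even. Qed.

Lemma evarX_eqmod0 m a n : (m.1 a < n)%N -> eqmod m (evar R a ^+ n) 0.
Proof.
move=> mn u v uv; rewrite evarX /=; case: eqP => // uE; move: mn.
by rewrite -uv uE /= msetE2 msetnxx ltnNge leq_addr.
Qed.

Lemma evar_eqmod0 m a : a \notin m.1 -> eqmod m (evar R a) 0.
Proof.
by move=> am; rewrite -[evar R a]expr1; apply: evarX_eqmod0; rewrite ltnS leqn0 mset_eq0.
Qed.

Lemma ovar_eqmod0 m a : a \notin m.2 -> eqmod m (ovar R a) 0.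
Proof.
move=> am u v uv; rewrite unlock /=; case: eqP => // uE; move: am.
by rewrite -uv uE /= !inE eqxx.
Qed.

Definition kernel_factor a b : superseries R :=
  (1 - evar R a * evar R b - ovar R a * ovar R b)^-1.

(** Let z be the product of the even variables and w that of the odd ones. As w^2 = 0, the power (z
    + w)^n only has the terms z^n and n z^(n-1) w; for n = [(m.1 a).+2] both contain [evar R a] more
    often than [m] does. *)
Lemma kernel_factor_unit a b :
  1 - evar R a * evar R b - ovar R a * ovar R b \is a GRing.unit.
Proof.
rewrite -addrA -opprD; apply: unitr_1sub => m; exists (m.1 a).+2.
rewrite exprDn_comm; last by apply: even_comm; apply: (@has_parityM false false); apply: evar_even.
apply: eqmod_sum0 => -[[|[|i]] /= _] _; rewrite ?bin0 ?bin1.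
- rewrite mulr1n mulr1 subn0 exprMn_comm; last exact: evar_central.
  by apply: eqmodMl0; apply: evarX_eqmod0; rewrite ltnW.
- rewrite -mulr_natr; do 2!apply: eqmodMl0; rewrite subSS subn0.
  by rewrite exprMn_comm; [apply: eqmodMl0; apply: evarX_eqmod0|exact: evar_central].
rewrite [X in _ * X]exprS [X in _ * X](_ : _ = 0) ?mulr0 ?mul0rn //.
rewrite exprS mulrA -[ovar R a * _ * _]mulrA [ovar R b * _]mulrA ovar_anticomm.
by rewrite !mulNr mulrN -[ovar R a * _ * _]mulrA ovar_sqr mulr0 mulr0 oppr0 mul0r.
Qed.

Lemma kernel_factor_central a b f : GRing.comm (kernel_factor a b) f.
Proof.
apply: commr_sym; apply: commrV; apply: commr_sym; apply: even_comm.
apply: has_parityD; last first.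
  by apply/has_parityN/(@has_parityM true true); apply: ovar_odd.
apply: has_parityD; first exact: has_parity1.
by apply/has_parityN/(@has_parityM false false); apply: evar_even.
Qed.

Lemma eqmod_divl m f g h : h \is a GRing.unit -> eqmod m (f * h) g ->
  eqmod m (g / h) f.
Proof.
move=> uh fhg; rewrite -[X in eqmod _ _ X](mulrK uh).
by apply: eqmodM; [apply: eqmod_sym|].
Qed.

(** A letter absent from [m] kills both products in the denominator. *)
Lemma kernel_factor_eqmod1 m a b :
  (a \notin m.1) && (a \notin m.2) || (b \notin m.1) && (b \notin m.2) ->
  eqmod m (kernel_factor a b) 1.
Proof.
move=> abm; rewrite -[kernel_factor a b]mul1r; apply: eqmod_divl.
  exact: kernel_factor_unit.
rewrite mul1r -addrA -opprD -[X in eqmod _ _ X]subr0; apply: eqmodB => //.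
rewrite -[X in eqmod _ _ X](addr0 0); case/orP: abm => /andP[m1 m2].
  by apply: eqmodD; apply: eqmodMl0; [apply: evar_eqmod0|apply: ovar_eqmod0].
by apply: eqmodD; apply: eqmodMr0; [apply: evar_eqmod0|apply: ovar_eqmod0].
Qed.

End Parity.

(** * Complete functions of finitely many variables *)

Section FiniteComplete.
Variable R : comNzRingType.
Implicit Types (f g : superseries R) (m u v : smonom) (a b : letter).

(* The [n]-th coefficient of [(\sum_n c_n t ^ n) / (1 - t y)]. *)
Definition geom_conv (y : superseries R) (c : nat -> superseries R) :=
  fix conv (n : nat) : superseries R :=
    c n + (if n is k.+1 then y * conv k else 0).

(* [hfin N n] and [htfin N n] are h_n and \tilde h_n of the pairs (y_j, phi_j) with
   [j < N]; the recursions come from clearing the last denominator of hgen. *)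
Fixpoint hfin (N : nat) : nat -> superseries R :=
  if N is N'.+1 then geom_conv (evar R (2, N')%N) (hfin N')
  else fun n => (n == 0%N)%:R.

Fixpoint htfin (N : nat) : nat -> superseries R :=
  if N is N'.+1 then geom_conv (evar R (2, N')%N)
    (fun n => htfin N' n + hfin N n * ovar R (2, N')%N)
  else fun=> 0.

Lemma geom_conv_ind (P : superseries R -> Prop) y c :
  (forall f g, P f -> P g -> P (f + g)) -> (forall f, P f -> P (y * f)) ->
  P 0 -> (forall n, P (c n)) -> forall n, P (geom_conv y c n).
Proof.
by move=> PD Py P0 Pc; elim=> [|n IH]; apply: PD => //; apply: Py.
Qed.

Lemma hfin0 N : hfin N 0 = 1.
Proof. by elim: N => //= N ->; rewrite addr0. Qed.

Lemma hfin_even N n : has_parity false (hfin N n).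
Proof.
elim: N n => [|N IH] n /=.
  by case: n => [|n] /=; [apply: has_parity1|apply: has_parity0].
apply: geom_conv_ind => //; first by move=> f g; apply: has_parityD.
by move=> f; apply: (@has_parityM _ false false); apply: evar_even.
Qed.

Lemma hfin_central N n f : GRing.comm (hfin N n) f.
Proof. exact/even_comm/hfin_even. Qed.

(** The two properties go together: the square of a sum vanishes because its summands anticommute.
    Oddness alone would only give 2 f^2 = 0, and 2 may be a zero divisor in [R]. *)
Lemma htfin_odd_sqr N n : has_parity true (htfin N n) /\ htfin N n * htfin N n = 0.
Proof.
pose P f := has_parity true f /\ f * f = 0.
have PD f g : P f -> P g -> P (f + g).
  move=> [of_ f0] [og g0]; split; first exact: has_parityD.
  by rewrite mulrDl !mulrDr f0 g0 add0r addr0 odd_anticomm // addNr.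
have PM f g : has_parity false f -> P g -> P (f * g).
  move=> ef [og g0]; split; first exact: has_parityM ef og.
  by rewrite mulrA -[f * g * f]mulrA -(even_comm g ef) mulrA -mulrA g0 mulr0.
elim: N n => [|N IH] n /=; first by rewrite mulr0.
apply: (@geom_conv_ind P) => //.
- by move=> f; apply: PM; apply: evar_even.
- by split=> //; rewrite mulr0.
move=> k; apply: PD => //; apply: PM; first exact: (@hfin_even N.+1).
by split; [apply: ovar_odd|rewrite ovar_sqr].
Qed.

Lemma htfin_odd N n : has_parity true (htfin N n).
Proof. by have [] := htfin_odd_sqr N n. Qed.

Lemma htfin_sqr N n : htfin N n * htfin N n = 0.
Proof. by have [] := htfin_odd_sqr N n. Qed.

(** The letter [a] stands for (t, tau): it is (0, 0) for [hgen] and (1, i) for the row of K with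
    index i. *)
Definition row_term a N n : superseries R :=
  evar R a ^+ n * (hfin N n + ovar R a * htfin N n).

(* Multiplying by the denominator of the factor of [(2, N)] telescopes. *)
Lemma row_term_telescope a N D :
  (\sum_(n < D.+1) row_term a N.+1 n) *
    (1 - evar R a * evar R (2, N)%N - ovar R a * ovar R (2, N)%N) =
  \sum_(n < D.+1) row_term a N n - evar R a * evar R (2, N)%N * row_term a N.+1 D.
Proof.
set T := evar R a; set y := evar R _; set th := ovar R a; set ph := ovar R _.
have Tc f : f * T = T * f by rewrite (evar_central a f).
have yc f : f * y = y * f by rewrite (evar_central _ f).
have Tyc n : (T * y) * row_term a N.+1 n =
    T ^+ n.+1 * (y * hfin N.+1 n + th * (y * htfin N.+1 n)).
  rewrite /row_term -/T -/th exprS -!mulrA; congr (T * _).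
  rewrite !mulrA -yc -!mulrA; congr (T ^+ n * _).
  by rewrite mulrDr; congr (_ + _); rewrite !mulrA yc.
(* Since [th] squares to zero, [th * ph] only meets the [hfin] part of the row. *)
have thht n : th * htfin N.+1 n * (th * ph) = 0.
  rewrite mulrA -[th * _ * th]mulrA -[htfin _ _ * th]opprK -odd_anticomm; last first.
  - exact: htfin_odd.
  - exact: ovar_odd.
  by rewrite mulrN mulrA ovar_sqr mul0r oppr0 mul0r.
(* The term added at index n + 1 is the one subtracted at index n, so only the last subtracted term
   survives summation. *)
have step n : row_term a N.+1 n * (1 - T * y - th * ph) =
    row_term a N n - (T * y) * row_term a N.+1 n +
    (if n is k.+1 then (T * y) * row_term a N.+1 k else 0).
  rewrite !mulrBr mulr1 [X in _ - X - _](_ : _ = T * y * row_term a N.+1 n); last first.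
    by move: (row_term _ _ _) => r; rewrite mulrA Tc -!mulrA yc.
  rewrite addrAC [in RHS]addrAC; congr (_ - _).
  rewrite {2}/row_term -/T -mulrA mulrDl -/th thht addr0 /row_term -/T -/th -mulrBr.
  have -> : hfin N.+1 n * (th * ph) = th * (hfin N.+1 n * ph).
    by rewrite mulrA (hfin_central N.+1 n th) mulrA.
  (* These are the recursions of [hfin] and [htfin], solved for the values with one pair of
     variables fewer. *)
  have -> : hfin N n + th * htfin N n = (hfin N.+1 n +
      th * htfin N.+1 n) - th * (hfin N.+1 n * ph) -
      (if n is k.+1 then y * hfin N.+1 k + th * (y * htfin N.+1 k) else 0).
    apply/eqP; rewrite eq_sym !subr_eq; apply/eqP.
    case: n => [|n]; rewrite /= ?addr0 !mulrDr; first by rewrite addrA.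
    by rewrite (AC (2*3) ((1*3)*(2*5)*4)).
  case: n => [|n]; first by rewrite subr0 addr0.
  rewrite -[T * y * _]/(T * y * row_term a N.+1 n) Tyc -mulrDr; congr (_ * _).
  by rewrite subrK.
elim: D => [|D IH].
  by rewrite !big_ord_recl !big_ord0 !addr0 step addr0.
rewrite big_ord_recr /= mulrDl IH step [in RHS]big_ord_recr /=.
set X := T * y * row_term _ _ D; set Y := T * y * _.
by rewrite [_ - Y + X]addrC addrA subrK addrA.
Qed.

(** By induction on the number of factors: clearing the last denominator leaves the telescoping
    remainder, which contains [evar R a ^+ D.+1] and so vanishes modulo [m]. *)
Lemma row_eqmod m a N D : (m.1 a <= D)%N ->
  eqmod m (\prod_(j <- iota 0 N) kernel_factor R a (2, j)%N)
    (\sum_(n < D.+1) row_term a N n).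
Proof.
move=> mD; elim: N => [|N IH].
  rewrite big_nil big_ord_recl big1 ?addr0 => [|i _]; rewrite /row_term /=.
    by rewrite mul1r mulr0 addr0.
  by rewrite mulr0 addr0 mulr0.
rewrite -addn1 iotaD big_cat big_seq1 /= add0n addn1.
apply: (eqmod_trans (eqmodM IH (eqmod_refl _))).
apply: eqmod_divl; first exact: kernel_factor_unit.
rewrite row_term_telescope -[X in eqmod _ _ X]subr0; apply: eqmodB => //.
rewrite (_ : _ * _ = evar R a ^+ D.+1 *
    (evar R (2, N)%N * (hfin N.+1 D + ovar R a * htfin N.+1 D))).
  by apply: eqmodMl0; apply: evarX_eqmod0.
rewrite exprS /row_term -!mulrA; congr (_ * _); rewrite !mulrA.
by rewrite (evar_central _ (evar R a ^+ D)).
Qed.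

Local Notation o := (0, 0)%N.

Definition ttau_free f : Prop :=
  forall m, (o \in m.1) || (o \in m.2) -> f m = 0.

Lemma ttau_freeM f g : ttau_free f -> ttau_free g -> ttau_free (f * g).
Proof.
move=> ff fg m om; rewrite smulrE big_seq big1 // => -[u v] /factorsP /= uv.
move: om; rewrite -uv /= in_msetD in_fsetU orbACA => /orP[/ff->|/fg->].
  by rewrite mul0r mulr0.
by rewrite !mulr0.
Qed.

Lemma ttau_freeD f g : ttau_free f -> ttau_free g -> ttau_free (f + g).
Proof. by move=> ff fg m om; rewrite addsE ff // fg // addr0. Qed.

Lemma ttau_free1 : ttau_free 1.
Proof.
move=> m; case: (eqVneq m smonom1) => [->|/negbTE n1 _]; last by rewrite /= n1.
by rewrite /= in_mset0 in_fset0.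
Qed.

Lemma ttau_free_evar j : ttau_free (evar R (2, j)%N).
Proof.
move=> m; rewrite unlock /=; case: eqP => // ->.
by rewrite /= in_mset1 in_fset0.
Qed.

Lemma ttau_free_ovar j : ttau_free (ovar R (2, j)%N).
Proof.
move=> m; rewrite unlock /=; case: eqP => // ->.
by rewrite /= in_mset0 in_fset1.
Qed.

Lemma ttau_free_hfin N n : ttau_free (hfin N n).
Proof.
elim: N n => [|N IH] n /=; first by case: n => //=; exact: ttau_free1.
apply: geom_conv_ind => //; first by move=> f g; apply: ttau_freeD.
by move=> f; apply: ttau_freeM; apply: ttau_free_evar.
Qed.

Lemma ttau_free_htfin N n : ttau_free (htfin N n).
Proof.
elim: N n => [|N IH] n //=.
apply: geom_conv_ind => //; first by move=> f g; apply: ttau_freeD.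
  by move=> f; apply: ttau_freeM; apply: ttau_free_evar.
move=> k; apply: ttau_freeD => //; apply: ttau_freeM; last exact: ttau_free_ovar.
exact: (@ttau_free_hfin N.+1).
Qed.

Lemma scoef_sum (I : Type) (s : seq I) (F : I -> superseries R) m :
  (\sum_(i <- s) F i) m = \sum_(i <- s) F i m.
Proof. by elim/big_rec2: _ => // i _ f _ <-. Qed.

(** Uniqueness of the expansion in t and tau when the coefficients are free of both. *)
Lemma ttau_coef_sum n p (D : nat) (A B : nat -> superseries R) : (n <= D)%N ->
  (forall k, ttau_free (A k)) -> (forall k, ttau_free (B k)) ->
  ttau_coef n p (\sum_(k < D.+1) tvar R ^+ k * (A k + tauvar R * B k)) =
  if p then B n else A n.
Proof.
move=> nD fA fB; apply: superseriesP => m; rewrite /=.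
case: ifPn => [om|]; first by case: p; rewrite ?fA ?fB.
rewrite negb_or => /andP[om1 om2]; rewrite scoef_sum.
rewrite (bigD1 (Ordinal (nD : (n < D.+1)%N))) //= big1 ?addr0 => [|[k kD] /=].
  rewrite /tvar evarX sterm_even_mull /= ifT; last first.
    by apply/msubsetP => a; rewrite msetE2 leq_addr.
  rewrite msetDKB /tauvar unlock sterm_odd_mull /=; case: p.
    rewrite fset1U1 fsetU1K // fA ?add0r; last by rewrite /= fset1U1 orbT.
    (* The letter of tau is the smallest one, so extracting it on the left costs no sign. *)
    rewrite /ssign fdisjoint1X om2 big_seq_fset1 big1 ?expr0 ?mul1r; first by case: (m).
    by move=> [i j] _; rewrite /letter_lt /= !ltn0 andbF.
  by rewrite (negbTE om2) addr0; case: (m).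
rewrite -val_eqE /= => kn; rewrite /tvar evarX sterm_even_mull.
(* If t^k divides the monomial then k < n, and the t left over is foreign to [A k] and [B k]. *)
case: ifP => // /msubsetP/(_ o); rewrite /= msetE2 !msetnxx.
have -> : m.1 o = 0%N by apply/eqP; rewrite mset_eq0.
rewrite addn0 => kn'.
have o1 S : o \in (((msetn n o `+` m.1) `\` msetn k o)%mset, S : {fset letter}).1.
  by rewrite /= in_msetB msetE2 !msetnxx ltn_addr // ltn_neqAle kn.
rewrite ?addsE fA ?o1 // add0r /tauvar unlock sterm_odd_mull /=.
by case: ifP => // _; rewrite fB ?o1 ?mulr0.
Qed.

(** Extraction reads [f] at monomials multiplied by t^n, and by tau if [p] holds, hence the larger
    modulus. *)
Lemma ttau_coef_eqmod m n p f g :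
  eqmod (smonomM (msetn n o, if p then [fset o]%fset else fset0) m) f g ->
  eqmod m (ttau_coef n p f) (ttau_coef n p g).
Proof.
move=> fg u v uv /=; case: ifP => // _; apply: (fg _ v).
rewrite -uv smonomMA; congr smonomM; rewrite /smonomM /=; congr pair.
by case: (p); rewrite ?fset0U.
Qed.

Lemma letter_bound m :
  {N : nat | forall k j, (N <= j)%N -> ((k, j) \notin m.1) && ((k, j) \notin m.2)}.
Proof.
pose s : seq letter := enum_mset m.1 ++ enum_fset m.2.
exists (\max_(a <- s) a.2).+1 => k j Nj; rewrite -negb_or; apply/negP => kj.
have : ((k, j).2 <= \max_(a <- s) a.2)%N.
  by apply: (@leq_bigmax_seq _ s xpredT (fun a : letter => a.2)); rewrite // mem_cat.
by rewrite leqNgt Nj.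
Qed.

(** The factors of [hgen] are kernel factors with first letter (0, 0); those from index [N] on are 1
    modulo [m], and [row_eqmod] treats the others. *)
Lemma hgen_eqmod m N :
  (forall j, N <= j -> ((2, j) \notin m.1) && ((2, j) \notin m.2))%N ->
  eqmod m (hgen (yvar R) (phivar R)) (\sum_(n < (m.1 o).+1) row_term o N n).
Proof.
move=> mN; have [] := @infprod_eqmod R nat (fun j => kernel_factor R o (2, j)%N).
- by move=> i j; apply: kernel_factor_central.
- move=> u; have [M uM] := letter_bound u.
  exists (iota 0 M); split; first exact: iota_uniq.
  move=> j; rewrite mem_iota add0n -leqNgt => /uM jm.
  by apply: kernel_factor_eqmod1; rewrite jm orbT.
move=> _ /(_ m (iota 0 N)) hE; apply: eqmod_trans (row_eqmod _ _) => //.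
apply: hE; split; first exact: iota_uniq.
move=> j; rewrite mem_iota add0n -leqNgt => /mN jm.
by apply: kernel_factor_eqmod1; rewrite jm orbT.
Qed.

Lemma hfun_eqmod m N n :
  (forall j, N <= j -> ((2, j) \notin m.1) && ((2, j) \notin m.2))%N ->
  eqmod m (hfun (yvar R) (phivar R) n) (hfin N n) /\
  eqmod m (hfun_tilde (yvar R) (phivar R) n) (htfin N n).
Proof.
move=> mN.
have H p : eqmod m (ttau_coef n p (hgen (yvar R) (phivar R)))
    (if p then htfin N n else hfin N n).
  pose m' := smonomM (msetn n o, if p then [fset o]%fset else fset0) m.
  have nm' : (n <= m'.1 o)%N by rewrite /= msetE2 msetnxx leq_addr.
  rewrite -(ttau_coef_sum p nm' (ttau_free_hfin N) (ttau_free_htfin N)).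
  (* Passing from [m] to [m'] only adds the letter (0, 0), so the bound [N] on the letters (2, j)
     persists. *)
  apply: ttau_coef_eqmod; apply: hgen_eqmod => j /mN /andP[j1 j2].
  rewrite /= in_msetD in_fsetU !negb_or j1 j2 in_msetn /= !andbT.
  by case: (p); rewrite ?in_fset0 ?in_fset1 /= andbT andbF.
by split; [apply: (H false)|apply: (H true)].
Qed.


End FiniteComplete.

(** * Choices of an exponent and possibly a theta for each index *)

Section Configurations.
(* [e i] gives the exponent of x_i and tells whether theta_i occurs. *)
Variables (N : nat) (e : nat -> nat * bool).
Implicit Types (i j : nat).

Definition wt i := (e i).1.
Definition wt_geq i j := (wt j <= wt i)%N.
Definition fermion_pos : seq nat := sort wt_geq [seq i <- iota 0 N | (e i).2].
Definition boson_pos : seq nat :=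
  sort wt_geq [seq i <- iota 0 N | ~~ (e i).2 && (wt i != 0%N)].
(** A bare pair of weakly decreasing lists: it is a superpartition exactly when no fermionic weight
    is repeated. *)
Definition config_shape : seq nat * seq nat :=
  (map wt fermion_pos, map wt boson_pos).

Lemma mem_fermion_pos i : (i \in fermion_pos) = (i < N)%N && (e i).2.
Proof. by rewrite mem_sort mem_filter mem_iota andbC. Qed.

Lemma mem_boson_pos i :
  (i \in boson_pos) = [&& (i < N)%N, ~~ (e i).2 & wt i != 0%N].
Proof. by rewrite mem_sort mem_filter mem_iota andbC. Qed.

Lemma fermion_pos_uniq : uniq fermion_pos.
Proof. by rewrite sort_uniq filter_uniq ?iota_uniq. Qed.

Lemma boson_pos_uniq : uniq boson_pos.
Proof. by rewrite sort_uniq filter_uniq ?iota_uniq. Qed.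

Lemma pos_uniq : uniq (fermion_pos ++ boson_pos).
Proof.
rewrite cat_uniq fermion_pos_uniq boson_pos_uniq andbT; apply/hasPn => i.
by rewrite mem_boson_pos /= mem_fermion_pos => /and3P[-> /negbTE->].
Qed.

Lemma wt_sorted (s : seq nat) : sorted geq (map wt (sort wt_geq s)).
Proof.
by rewrite sorted_map; apply: sort_sorted => i j; apply: leq_total.
Qed.

Lemma config_shape_sorted :
  sorted geq config_shape.1 /\ sorted geq config_shape.2.
Proof. by split; apply: wt_sorted. Qed.

Lemma config_shape_bosonic : 0%N \notin config_shape.2.
Proof.
by apply/mapP => -[i]; rewrite mem_boson_pos => /and3P[_ _ /eqP wi] /esym.
Qed.

(** The third block holds the positions that will contribute only h_0 = 1. *)
Lemma perm_iota_pos : perm_eq (iota 0 N)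
  (fermion_pos ++ boson_pos ++ [seq i <- iota 0 N | ~~ (e i).2 && (wt i == 0%N)]).
Proof.
apply: uniq_perm; first exact: iota_uniq.
  rewrite catA cat_uniq pos_uniq filter_uniq ?iota_uniq // andbT.
  apply/hasPn => i; rewrite mem_filter mem_cat mem_boson_pos mem_fermion_pos.
  by move=> /andP[/andP[/negbTE-> /eqP->] _]; rewrite !andbF.
move=> i; rewrite !mem_cat mem_boson_pos mem_fermion_pos mem_filter mem_iota /=.
by rewrite add0n; case: (i < N)%N; case: (e i).2; case: eqP.
Qed.

End Configurations.

(** * Sorting the product of the chosen factors, and the resulting sign *)

Section ProductRearrangement.
Variables (A : nzRingType) (x theta h ht : nat -> A).
Hypothesis x_central : forall i f, GRing.comm (x i) f.
Hypothesis h_central : forall n f, GRing.comm (h n) f.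
Hypothesis h0 : h 0%N = 1.
Hypothesis theta_ht : forall i n, theta i * ht n = - (ht n * theta i).
Hypothesis theta_ht_central : forall i n f, GRing.comm (theta i * ht n) f.
Hypothesis ht_sqr : forall n, ht n * ht n = 0.
Variables (N : nat) (e : nat -> nat * bool).
Local Notation wt := (wt e).

Definition config_factor i : A :=
  x i ^+ wt i * (if (e i).2 then theta i * ht (wt i) else h (wt i)).

Definition config_term : A :=
  (\prod_(i <- fermion_pos N e) theta i) *
  \prod_(i <- fermion_pos N e ++ boson_pos N e) x i ^+ wt i.

Lemma xX_central i n f : GRing.comm (x i ^+ n) f.
Proof. by apply/commr_sym/commrX/commr_sym. Qed.

Lemma prod_xX_central (s : seq nat) f : GRing.comm (\prod_(i <- s) x i ^+ wt i) f.
Proof. by apply/commr_sym/commr_prod => i _; apply/commr_sym/xX_central. Qed.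

Lemma config_factor_central i f : GRing.comm (config_factor i) f.
Proof.
apply: commr_sym; apply: commrM; first exact/commr_sym/xX_central.
by case: (e i).2; apply: commr_sym.
Qed.

Lemma ht_prod_theta (s : seq nat) n : ht n * \prod_(i <- s) theta i =
  (-1) ^+ size s * (\prod_(i <- s) theta i) * ht n.
Proof.
elim: s => [|i s IH]; first by rewrite big_nil !mulr1 mul1r.
rewrite big_cons mulrA -[ht n * _]opprK -theta_ht mulNr -[theta i * _ * _]mulrA IH /= exprS.
rewrite !mulrA mulN1r !mulNr; congr (- (_ * _ * _)).
exact: commr_sign.
Qed.

(** When a factor is put in front of n others, its [ht] has to cross their n thetas, which gives
    (-1)^n; and n(n-1)/2 + n = (n+1)n/2. *)
Lemma prod_fermion_factors (s : seq nat) :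
  \prod_(i <- s) (x i ^+ wt i * (theta i * ht (wt i))) =
  (-1) ^+ (size s * (size s).-1)./2 *
  ((\prod_(i <- s) theta i) * \prod_(i <- s) x i ^+ wt i) *
  \prod_(n <- map wt s) ht n.
Proof.
elim: s => [|i s IH]; first by rewrite !big_nil !mulr1.
rewrite big_cons IH map_cons !big_cons /=.
have -> : ((size s).+1 * size s)./2 = ((size s * (size s).-1)./2 + size s)%N.
  by have := bin2 (size s).+1; rewrite /= => <-; rewrite -bin2 binS bin1.
set p := (size s * _)./2; set X := \prod_(j <- s) x j ^+ _.
set T := \prod_(j <- s) theta j; set P := \prod_(j <- _) ht j.
have sc n (f : A) : (-1) ^+ n * f = f * (-1) ^+ n by apply/esym/commr_sign.
set a := x i ^+ _; set t := ht (wt i).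
have sM n (u f : A) : u * ((-1) ^+ n * f) = (-1) ^+ n * (u * f) by rewrite mulrA -sc mulrA.
have aM u f : u * (a * f) = a * (u * f).
  by rewrite !mulrA (xX_central i (wt i) u).
have tX f : t * (X * f) = X * (t * f).
  by rewrite !mulrA (prod_xX_central s t).
have tT f : t * (T * f) = (-1) ^+ size s * (T * (t * f)).
  by rewrite mulrA ht_prod_theta -!mulrA.
rewrite exprD -!mulrA (sM p t) (sM p (theta i)) (sM p a); congr (_ * _).
by rewrite tT tX (sM _ (theta i)) (sM _ a) (aM T) (aM (theta i)).
Qed.

(** The factors commute, so two of equal weight can be made adjacent; moving the second theta to the
    left then produces [ht w * ht w]. *)
Lemma prod_fermion_factors_eq0 (s : seq nat) : ~~ uniq (map wt s) ->
  \prod_(i <- s) (x i ^+ wt i * (theta i * ht (wt i))) = 0.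
Proof.
elim: s => //= i s IH; rewrite negb_and negbK big_cons => /orP[|/IH ->]; last first.
  by rewrite mulr0.
move=> /mapP[j js wij]; rewrite (perm_big_comm _ (perm_to_rem js)); last first.
  move=> k l; apply: commr_sym; apply: commrM; first exact/commr_sym/xX_central.
  exact/commr_sym/theta_ht_central.
rewrite big_cons -wij [LHS]mulrA; set w := wt i.
suff -> : x i ^+ w * (theta i * ht w) * (x j ^+ w * (theta j * ht w)) = 0.
  by rewrite mul0r.
rewrite -mulrA; set f := x i ^+ w; rewrite [_ * (x j ^+ w * _)]mulrA.
rewrite -(xX_central j w (theta i * ht w)) -!mulrA [ht w * (theta j * _)]mulrA.
rewrite -[ht w * theta j]opprK -theta_ht mulNr -!mulrA ht_sqr mulr0 oppr0.
by rewrite !mulr0.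
Qed.

Lemma prod_boson_factors (s : seq nat) :
  \prod_(i <- s) (x i ^+ wt i * h (wt i)) =
  \prod_(i <- s) x i ^+ wt i * \prod_(n <- map wt s) h n.
Proof.
elim: s => [|i s IH]; first by rewrite !big_nil mulr1.
rewrite map_cons !big_cons IH !mulrA; congr (_ * _).
by rewrite -!mulrA; congr (_ * _); rewrite h_central.
Qed.

Lemma prod_config_factor : \prod_(i <- iota 0 N) config_factor i =
  if uniq (config_shape N e).1 then
    (-1) ^+ (size (config_shape N e).1 * (size (config_shape N e).1).-1)./2 *
    config_term *
    (\prod_(n <- (config_shape N e).1) ht n * \prod_(n <- (config_shape N e).2) h n)
  else 0.
Proof.
rewrite (perm_big_comm _ (perm_iota_pos N e)); last first.
  by move=> i j; apply: config_factor_central.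
rewrite !big_cat /= [X in _ * (_ * X)]big_seq [X in _ * (_ * X)]big1 ?mulr1; last first.
  move=> i; rewrite mem_filter => /andP[/andP[/negbTE bi /eqP wi] _].
  by rewrite /config_factor bi wi h0 mulr1.
have -> : \prod_(i <- fermion_pos N e) config_factor i =
    \prod_(i <- fermion_pos N e) (x i ^+ wt i * (theta i * ht (wt i))).
  rewrite big_seq [RHS]big_seq; apply: eq_bigr => i.
  by rewrite mem_fermion_pos /config_factor => /andP[_ ->].
have -> : \prod_(i <- boson_pos N e) config_factor i =
    \prod_(i <- boson_pos N e) (x i ^+ wt i * h (wt i)).
  rewrite big_seq [RHS]big_seq; apply: eq_bigr => i.
  by rewrite mem_boson_pos /config_factor => /and3P[_ /negbTE ->].
case: ifPn => [_|/prod_fermion_factors_eq0 ->]; last by rewrite mul0r.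
rewrite prod_fermion_factors prod_boson_factors size_map /config_term big_cat /=.
rewrite -!mulrA; do 3!congr (_ * _); rewrite !mulrA; congr (_ * _).
by rewrite (prod_xX_central (boson_pos N e)).
Qed.

End ProductRearrangement.

(** * Configurations as terms of the supermonomial *)

Section SupermonomialTerms.
Variable R : comNzRingType.
Implicit Types (m u v : smonom) (L : superpartition) (e : nat -> nat * bool).
Local Notation x := (xvar R).
Local Notation theta := (thetavar R).

Lemma config_term_smonomial N e L : config_shape N e = spart L ->
  exists2 s : nat -> nat, bijective s &
    config_term x theta N e = smonomial_term x theta L s.
Proof.
move=> eL; have pq := perm_iota_pos N e.
set rest := [seq i <- _ | _] in pq; set r := fermion_pos N e ++ boson_pos N e.
pose q := r ++ rest; have {}pq : perm_eq (iota 0 N) q by rewrite /q /r -catA.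
have sq : size q = N by rewrite -(perm_size pq) size_iota.
have uq : uniq q by rewrite -(perm_uniq pq) iota_uniq.
have mq i : (i \in q) = (i < N)%N by rewrite -(perm_mem pq) mem_iota.
(* The default value [i] makes [s] the identity from [N] on, hence a bijection of all natural
   numbers. *)
pose s i := nth i q i.
have sr k : (k < size r)%N -> s k = nth 0%N r k.
  by move=> kr; rewrite /s nth_cat kr; apply: set_nth_default.
exists s.
  exists (fun j => if j \in q then index j q else j) => [i|j].
    rewrite /s; have [iN|Ni] := ltnP i N.
      by rewrite mem_nth ?sq // index_uniq ?sq.
    by rewrite nth_default ?sq // mq ltnNge Ni.
  rewrite /s; case: ifPn => [jq|]; first by rewrite nth_index.
  by rewrite mq -leqNgt => Nj; rewrite nth_default ?sq.
have sF : size (fermionic L) = size (fermion_pos N e).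
  by rewrite /fermionic -eL size_map.
have sL : slength L = size r.
  by rewrite /slength sF /bosonic -eL size_map size_cat.
rewrite /config_term /smonomial_term; congr (_ * _).
  rewrite (big_nth 0%N) big_mkord sF; apply: eq_bigr => i _.
  by rewrite sr ?nth_cat ?ltn_ord // size_cat ltn_addr.
rewrite (big_nth 0%N) big_mkord sL; apply: eq_bigr => i _.
rewrite sr //; congr (_ ^+ _).
by rewrite /sentry /fermionic /bosonic -eL -map_cat (nth_map 0%N).
Qed.

(** Converse to [config_term_smonomial]: the configuration read off the term of [L] permuted by
    [s]. *)
Definition permuted_config L (s : nat -> nat) (i : nat) : nat * bool :=
  let r := map s (iota 0 (slength L)) in
  if i \in r then (sentry L (index i r), (index i r < size (fermionic L))%N)
  else (0%N, false).

Lemma permuted_configE L s k : injective s -> (k < slength L)%N ->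
  permuted_config L s (s k) = (sentry L k, (k < size (fermionic L))%N).
Proof.
move=> injs kL; rewrite /permuted_config map_f ?mem_iota //.
by rewrite index_map // -{1 2}[k](nth_iota 0%N 0%N kL) index_uniq ?iota_uniq ?size_iota.
Qed.

Lemma sentry_fermionic L :
  [seq sentry L k | k <- iota 0 (size (fermionic L))] = fermionic L.
Proof.
apply: (@eq_from_nth _ 0%N); rewrite ?size_map ?size_iota // => i iF.
by rewrite (nth_map 0%N) ?size_iota // nth_iota // /sentry nth_cat iF.
Qed.

Lemma sentry_bosonic L :
  [seq sentry L k | k <- iota (size (fermionic L)) (size (bosonic L))] = bosonic L.
Proof.
apply: (@eq_from_nth _ 0%N); rewrite ?size_map ?size_iota // => i iF.
rewrite (nth_map 0%N) ?size_iota // nth_iota // /sentry nth_cat.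
by rewrite ltnNge leq_addr /= addKn.
Qed.

Lemma superpartitionP L : [/\ sorted gtn (fermionic L), sorted geq (bosonic L)
  & 0%N \notin bosonic L].
Proof. by case: L => L LP; case/and3P: (LP). Qed.

(** The sorted positions are permutations of the images under [s] of the fermionic and bosonic
    indices, and decreasing lists of weights with the same entries coincide. *)
Lemma permuted_config_term N L s : injective s ->
  (forall k, k < slength L -> s k < N)%N ->
  config_shape N (permuted_config L s) = spart L /\
  config_term x theta N (permuted_config L s) = smonomial_term x theta L s.
Proof.
move=> injs sN; set e := permuted_config L s.
have [sortF sortB B0] := superpartitionP L.
pose rF := map s (iota 0 (size (fermionic L))).
pose rB := map s (iota (size (fermionic L)) (size (bosonic L))).
have rE : map s (iota 0 (slength L)) = rF ++ rB by rewrite -map_cat iotaD.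
have wtF : map (wt e) rF = fermionic L.
  rewrite -map_comp -[RHS]sentry_fermionic; apply/eq_in_map => k; rewrite mem_iota /= => kF.
  by rewrite /wt /e permuted_configE // ltn_addr.
have wtB : map (wt e) rB = bosonic L.
  rewrite -map_comp -[RHS]sentry_bosonic; apply/eq_in_map => k.
  by rewrite mem_iota => /andP[_ kL] /=; rewrite /wt /e permuted_configE.
have memF k : (k \in rF) = (k < N)%N && (e k).2.
  apply/mapP/andP => [[i]|[_]].
    rewrite mem_iota /= => iF ->.
    by rewrite sN /e ?permuted_configE // ltn_addr.
  rewrite /e /permuted_config; case: ifP => // /mapP[i]; rewrite mem_iota /= => iL ->.
  rewrite index_map // -{1}[i](nth_iota 0%N 0%N iL) index_uniq ?iota_uniq ?size_iota // => iF.
  by exists i; rewrite ?mem_iota.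
have memB k : (k \in rB) = [&& (k < N)%N, ~~ (e k).2 & wt e k != 0%N].
  apply/idP/and3P => [kB|[kN kF k0]].
    split; last by apply: contraNneq B0 => k0; rewrite -wtB -k0 map_f.
      by case/mapP: kB => i; rewrite mem_iota => /andP[_ iL] ->; apply: sN.
    case/mapP: kB => i; rewrite mem_iota => /andP[Fi iL] ->.
    by rewrite /e permuted_configE //= -leqNgt.
  have : k \in rF ++ rB.
    rewrite -rE; move: k0; rewrite /wt /e /permuted_config.
    by case: ifP => //=.
  by rewrite mem_cat memF kN (negbTE kF).
have urF : uniq rF by rewrite map_inj_uniq ?iota_uniq.
have urB : uniq rB by rewrite map_inj_uniq ?iota_uniq.
have pF : perm_eq (fermion_pos N e) rF.
  by apply: uniq_perm => //; rewrite ?fermion_pos_uniq // => i; rewrite mem_fermion_pos memF.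
have pB : perm_eq (boson_pos N e) rB.
  by apply: uniq_perm => //; rewrite ?boson_pos_uniq // => i; rewrite mem_boson_pos memB.
have geq_trans : transitive geq by move=> a b c ab bc; apply: leq_trans bc ab.
have geq_anti : antisymmetric geq by move=> a b /andP[ab ba]; apply/eqP; rewrite eqn_leq; apply/andP.
have [shF shB] := config_shape_sorted N e.
have eF : map (wt e) (fermion_pos N e) = fermionic L.
  apply: (sorted_eq geq_trans geq_anti shF); last by rewrite -wtF; apply: perm_map.
  by move: sortF; rewrite gtn_sorted_uniq_geq => /andP[].
have eB : map (wt e) (boson_pos N e) = bosonic L.
  by apply: (sorted_eq geq_trans geq_anti shB) => //; rewrite -wtB; apply: perm_map.
split; first by rewrite /config_shape eF eB; case: (L) => -[].
pose gt_wt := relpre (wt e) gtn.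
(* Fermionic weights decrease strictly, so the positions themselves agree in order; another order of
   the thetas could change the sign. *)
have fE : fermion_pos N e = rF.
  apply: (@irr_sorted_eq _ gt_wt); rewrite ?/gt_wt.
  - by move=> a b c ab bc; apply: ltn_trans bc ab.
  - by move=> a; apply: ltnn.
  - by rewrite -sorted_map eF.
  - by rewrite -sorted_map wtF.
  exact: perm_mem.
rewrite /config_term /smonomial_term fE; congr (_ * _).
  by rewrite big_map -{1}[size (fermionic L)]subn0 -/(index_iota _ _) big_mkord.
(* Equal bosonic parts may be listed in another order, but the powers of [x] commute. *)
rewrite (@perm_big_comm _ _ _ _ (rF ++ rB)) ?perm_cat2l //; last first.
  by move=> i j; apply/commr_sym/commrX/commr_sym/commrX/commr_sym/evar_central.
rewrite -rE big_map -{1}[slength L]subn0 -/(index_iota _ _) big_mkord.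
by apply: eq_bigr => i _; rewrite /wt /e permuted_configE.
Qed.

Lemma eqmod_prod0 m (I : eqType) (r : seq I) (F : I -> superseries R) i :
  i \in r -> eqmod m (F i) 0 -> eqmod m (\prod_(j <- r) F j) 0.
Proof.
move=> ir Fi; elim: r ir => // j r IH; rewrite inE big_cons => /orP[/eqP <-|/IH].
  exact: eqmodMl0.
exact: eqmodMr0.
Qed.

Lemma smonomial_term_eqmod0 m N D L s k :
  (forall j, N <= j -> ((1, j) \notin m.1) && ((1, j) \notin m.2))%N ->
  (forall a, m.1 a <= D)%N ->
  (k < slength L)%N -> (N <= s k)%N || (D < sentry L k)%N ->
  eqmod m (smonomial_term x theta L s) 0.
Proof.
move=> mN mD kL; rewrite /smonomial_term.
have Xk : (m.1 (1%N, s k) < sentry L k)%N ->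
    eqmod m (\prod_(i < slength L) x (s i) ^+ sentry L i) 0.
  move=> mk; apply: (@eqmod_prod0 _ _ _ _ (Ordinal kL)); rewrite ?mem_index_enum //.
  exact: evarX_eqmod0.
case/orP => [/mN/andP[m1 m2]|Dk]; last first.
  by apply: eqmodMr0; apply: Xk; apply: leq_ltn_trans Dk.
(* A fermionic entry may be 0, so there it is [theta] that vanishes; a bosonic entry is positive, so
   there the power of [x] does. *)
have [kF|Fk] := ltnP k (size (fermionic L)).
  apply: eqmodMl0.
  apply: (@eqmod_prod0 _ _ _ _ (Ordinal kF)); rewrite ?mem_index_enum //.
  exact: ovar_eqmod0.
apply: eqmodMr0; apply: Xk; rewrite (_ : m.1 _ = 0%N); last by apply/eqP; rewrite mset_eq0.
have [_ _ B0] := superpartitionP L; rewrite lt0n; apply: contraNneq B0 => <-.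
rewrite /sentry nth_cat ltnNge Fk /= mem_nth // ltn_subLR //.
Qed.

Lemma signr_coef n (f : superseries R) m : ((-1) ^+ n * f) m = (-1) ^+ n * f m.
Proof. by rewrite -!(signr_odd _ n); case: odd; rewrite ?expr1 ?mulN1r ?mul1r. Qed.

(** The sign is left unspecified, since injectivity only needs the monomial. *)
Lemma prod_thetavar (s : seq nat) : uniq s -> exists n, exists2 S : {fset letter},
  \prod_(i <- s) theta i = (-1) ^+ n * sterm R (mset0, S) &
  forall i, ((1, i)%N \in S) = (i \in s).
Proof.
elim: s => [_|i s IH /= /andP[is_ /IH[n [S sE SE]]]].
  by exists 0%N, fset0 => [|i]; rewrite ?big_nil ?mulr1.
exists (n + \sum_(a <- [fset (1, i)%N]%fset) \sum_(b <- S) letter_lt b a)%N.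
exists ((1, i)%N |` S)%fset => [|j]; last first.
  by rewrite !inE SE xpair_eqE eqxx.
rewrite big_cons sE mulrA (commr_sign _ n) exprD -!mulrA; congr (_ * _).
apply: superseriesP => m; rewrite signr_coef /thetavar unlock sterm_mul /smonomM /= mset0D.
by rewrite /ssign fdisjoint1X SE is_.
Qed.

Lemma prod_xvar (s : seq nat) (w : nat -> nat) : uniq s -> exists2 v : {mset letter}%mset,
  \prod_(i <- s) x i ^+ w i = sterm R (v, fset0) &
  forall i, v (1, i)%N = if i \in s then w i else 0%N.
Proof.
elim: s => [_|i s IH /= /andP[is_ /IH[v sE vE]]].
  by exists mset0 => [|i]; rewrite ?big_nil ?mset0E.
exists (msetn (w i) (1, i)%N `+` v)%mset => [|j].
  rewrite big_cons sE /xvar evarX; apply: superseriesP => m.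
  by rewrite sterm_mul ssign0A mul1r /smonomM /= fset0U.
rewrite msetE2 msetnE vE inE xpair_eqE eqxx /=.
by case: eqVneq => [->|]; rewrite ?(negbTE is_) ?addn0.
Qed.

(** A term is a monomial up to sign, and this monomial gives back [e] below [N]. This matches the
    fact that [smonomial] counts each distinct term once. *)
Lemma config_term_inj N e e' :
  config_term x theta N e = config_term x theta N e' ->
  forall i, (i < N)%N -> e i = e' i.
Proof.
have H e0 : exists n, exists2 u, config_term x theta N e0 = (-1) ^+ n * sterm R u &
    forall i, (i < N)%N -> e0 i = (u.1 (1, i)%N, (1, i)%N \in u.2).
  have [n [S tE SE]] := prod_thetavar (fermion_pos_uniq N e0).
  have [v xE vE] := prod_xvar (wt e0) (pos_uniq N e0).
  exists n, (v, S); rewrite /config_term ?tE ?xE.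
    rewrite -mulrA; congr (_ * _); apply: superseriesP => m.
    by rewrite sterm_mul ssignA0 mul1r /smonomM /= mset0D fsetU0.
  move=> i iN; rewrite /= SE vE mem_cat mem_fermion_pos mem_boson_pos iN /=.
  by rewrite /wt; case: (e0 i) => [[|k] []].
have [n [u -> eu]] := H e; have [n' [u' -> eu']] := H e'.
(* At [u] the left side is a sign, hence nonzero, which forces [u = u']. *)
move=> /(congr1 (fun f => scoef f u)); rewrite !signr_coef /= eqxx mulr1.
have [uu' _ i iN|_ /eqP] := eqVneq u u'; last by rewrite mulr0 signr_eq0.
by rewrite eu // eu' // uu'.
Qed.

End SupermonomialTerms.

(** * Expansion of the kernel and the sum over superpartitions *)

Section KernelExpansion.
Variable R : comNzRingType.
Implicit Types (m u v : smonom) (L : superpartition).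
Local Notation x := (xvar R).
Local Notation theta := (thetavar R).
Local Notation config N D := {ffun 'I_N -> 'I_D.+1 * bool}.

Definition config_fun N D (c : config N D) (i : nat) : nat * bool :=
  if insub i is Some k then (val (c k).1, (c k).2) else (0%N, false).

Lemma config_funE N D (c : config N D) (k : 'I_N) :
  config_fun c k = (val (c k).1, (c k).2).
Proof. by rewrite /config_fun valK. Qed.

Lemma config_fun_surj N D (e : nat -> nat * bool) :
  (forall i, (e i).1 <= D)%N -> (forall i, (N <= i)%N -> e i = (0%N, false)) ->
  exists c : config N D, config_fun c = e.
Proof.
move=> eD eN; exists [ffun k : 'I_N => (inord (e k).1, (e k).2)].
apply/funext => i; rewrite /config_fun; case: insubP => [k _ <-|].
  by rewrite ffunE /= inordK ?ltnS //; case: (e k).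
by rewrite -leqNgt => /eN.
Qed.

Lemma mult_bound m : {D : nat | forall a, (m.1 a <= D)%N}.
Proof.
exists (\max_(a <- enum_mset m.1) m.1 a)%N => a.
have [am|] := boolP (a \in m.1); last by rewrite -mset_eq0 => /eqP->.
exact: (@leq_bigmax_seq _ _ xpredT m.1).
Qed.

Lemma smonomial_eqmod m N D L :
  (forall j, N <= j -> ((1, j) \notin m.1) && ((1, j) \notin m.2))%N ->
  (forall a, m.1 a <= D)%N ->
  eqmod m (smonomial x theta L)
    (\sum_(c : config N D | config_shape N (config_fun c) == spart L)
      config_term x theta N (config_fun c)).
Proof.
pose s N' D' := [seq config_term x theta N' (config_fun c) |
  c <- [seq c <- enum {: config N' D'} | config_shape N' (config_fun c) == spart L]].
set U := [set u | exists2 s : nat -> nat, bijective s &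
                    u = smonomial_term x theta L s]%classic.
(* Applying [infsum_eqmod] requires a support for every monomial, hence the generality in [m'], [N']
   and [D']. *)
have sP m' N' D' :
    (forall j, N' <= j -> ((1, j) \notin m'.1) && ((1, j) \notin m'.2))%N ->
    (forall a, m'.1 a <= D')%N -> sum_support m' U id (s N' D').
  move=> mN mD; split.
  - rewrite map_inj_uniq; first by apply: filter_uniq; apply: enum_uniq.
    move=> c c' /config_term_inj cc'.
    apply/ffunP => k; have := cc' k (ltn_ord k); rewrite !config_funE.
    by case: (c k) (c' k) => [a b] [a' b'] [/val_inj -> ->].
  - move=> u /mapP[c]; rewrite mem_filter => /andP[/eqP cL _] ->.
    exact: config_term_smonomial.
  move=> u [t bt ->] nu.
  (* A permuted term either exceeds a bound and vanishes modulo [m'], or comes from a configuration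
     in the list. *)
  have [/existsP[k bad]|] := boolP [exists k : 'I_(slength L),
      (N' <= t k)%N || (D' < sentry L k)%N].
    by apply: (@smonomial_term_eqmod0 R m' N' D' L t k).
  rewrite negb_exists => /forallP good; case/negP: nu.
  have tN k : (k < slength L)%N -> (t k < N')%N.
    by move=> kL; have := good (Ordinal kL); rewrite negb_or -ltnNge => /andP[].
  have [shE <-] := permuted_config_term R (bij_inj bt) tN.
  have [i|i Ni|c cE] := @config_fun_surj N' D' (permuted_config L t).
  - rewrite /permuted_config; case: ifP => // ir /=.
    have kL : (index i (map t (iota 0 (slength L))) < slength L)%N.
      by rewrite -[X in (_ < X)%N](size_iota 0) -(size_map t) index_mem.
    by have := good (Ordinal kL); rewrite negb_or -!leqNgt => /andP[].
  - rewrite /permuted_config; case: ifP => // /mapP[k].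
    by rewrite mem_iota => /tN kN iE; rewrite iE leqNgt kN in Ni.
  by apply/mapP; exists c; rewrite ?cE // mem_filter cE shE eqxx mem_enum.
have [|_ sumE] := @infsum_eqmod R _ U id.
  move=> m'; have [N' mN] := letter_bound m'; have [D' mD] := mult_bound m'.
  by exists (s N' D'); apply: sP => // j; apply: mN.
move=> mN mD; have := sumE m _ (sP _ _ _ mN mD).
by rewrite big_map big_filter big_enum_cond.
Qed.

Lemma hsuperE (X Theta : nat -> superseries R) L : hsuper X Theta L =
  \prod_(n <- fermionic L) hfun_tilde X Theta n *
  \prod_(n <- bosonic L) hfun X Theta n.
Proof.
rewrite -[in RHS](sentry_fermionic L) -[in RHS](sentry_bosonic L) !big_map.
rewrite /hsuper; congr (_ * _); last by rewrite /index_iota addKn.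
by rewrite -[in RHS](subn0 (size (fermionic L))) -/(index_iota _ _) big_mkord.
Qed.

Definition hsuper_fin N (F B : seq nat) : superseries R :=
  \prod_(n <- F) htfin R N n * \prod_(n <- B) hfin R N n.

Lemma hsuper_eqmod m N L :
  (forall j, N <= j -> ((2, j) \notin m.1) && ((2, j) \notin m.2))%N ->
  eqmod m (hsuper (yvar R) (phivar R) L) (hsuper_fin N (fermionic L) (bosonic L)).
Proof.
move=> mN; rewrite hsuperE.
by apply: eqmodM; apply: eqmod_prod => n _; have [] := hfun_eqmod R n mN.
Qed.

(** Distributivity: choosing a summand in each row amounts to choosing a configuration. *)
Lemma prod_row_terms N D :
  \prod_(i <- iota 0 N) \sum_(n < D.+1) row_term R (1, i)%N N n =
  \sum_(c : config N D) \prod_(i <- iota 0 N)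
    config_factor x theta (hfin R N) (htfin R N) (config_fun c) i.
Proof.
pose F i (q : 'I_D.+1 * bool) : superseries R :=
  x i ^+ q.1 * (if q.2 then theta i * htfin R N q.1 else hfin R N q.1).
have rowE i : \sum_(n < D.+1) row_term R (1, i)%N N n = \sum_q F i q.
  rewrite -(pair_bigA _ (fun n b => F i (n, b))); apply: eq_bigr => n _ /=.
  by rewrite big_bool /F /= -mulrDr addrC.
rewrite -[in iota 0 N](subn0 N) -/(index_iota 0 N) big_mkord.
under eq_bigr do rewrite rowE.
rewrite bigA_distr_bigA /=; apply: eq_bigr => c _.
by rewrite big_mkord; apply: eq_bigr => k _; rewrite /config_factor /wt config_funE.
Qed.

Lemma kernel_eqmod m N D :
  (forall k j, N <= j -> ((k, j) \notin m.1) && ((k, j) \notin m.2))%N ->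
  (forall a, m.1 a <= D)%N ->
  eqmod m (\prod_(ij <- [seq (i, j) | i <- iota 0 N, j <- iota 0 N])
      kernel_factor R (1, ij.1)%N (2, ij.2)%N)
    (\sum_(c : config N D) \prod_(i <- iota 0 N)
      config_factor x theta (hfin R N) (htfin R N) (config_fun c) i).
Proof.
move=> mN mD; rewrite -prod_row_terms big_allpairs.
by apply: eqmod_prod => i _; exact: (row_eqmod R N (mD (1, i)%N)).
Qed.

Lemma prod_config_fin N (e : nat -> nat * bool) :
  \prod_(i <- iota 0 N) config_factor x theta (hfin R N) (htfin R N) e i =
  if uniq (config_shape N e).1 then
    overleftarrow (size (config_shape N e).1) (config_term x theta N e) *
    hsuper_fin N (config_shape N e).1 (config_shape N e).2
  else 0.
Proof.
apply: prod_config_factor.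
- by move=> i f; apply: evar_central.
- exact: hfin_central.
- exact: hfin0.
- by move=> i n; apply: odd_anticomm; [apply: ovar_odd|apply: htfin_odd].
- move=> i n f; apply: even_comm.
  by apply: (@has_parityM _ true true); [apply: ovar_odd|apply: htfin_odd].
exact: htfin_sqr.
Qed.

(** [insub] drops the shapes with a repeated fermionic weight, whose products are 0. *)
Definition config_shapes N D : seq superpartition :=
  undup (pmap insub [seq config_shape N (config_fun c) | c <- enum {: config N D}]).

Lemma mem_config_shapes N D L (c : config N D) :
  config_shape N (config_fun c) = spart L -> L \in config_shapes N D.
Proof.
move=> cL; rewrite mem_undup mem_pmap; apply/mapP; exists (spart L).
  by apply/mapP; exists c; rewrite ?mem_enum.
by rewrite -[in LHS](valK L).
Qed.

Definition kernel_term L : superseries R :=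
  overleftarrow (size (fermionic L)) (smonomial x theta L) *
  hsuper (yvar R) (phivar R) L.

Lemma kernel_term_eqmod m N D L :
  (forall k j, N <= j -> ((k, j) \notin m.1) && ((k, j) \notin m.2))%N ->
  (forall a, m.1 a <= D)%N ->
  eqmod m (kernel_term L)
    (\sum_(c : config N D | config_shape N (config_fun c) == spart L)
      overleftarrow (size (config_shape N (config_fun c)).1)
        (config_term x theta N (config_fun c)) *
      hsuper_fin N (config_shape N (config_fun c)).1
        (config_shape N (config_fun c)).2).
Proof.
move=> mN mD; have := eqmodM (eqmodM (@eqmod_refl _ m
  ((-1) ^+ (size (fermionic L) * (size (fermionic L)).-1)./2))
  (smonomial_eqmod L (mN 1%N) mD)) (hsuper_eqmod L (mN 2%N)).
move/eqmod_trans; apply; rewrite mulr_sumr mulr_suml.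
rewrite [X in eqmod _ X _](eq_bigr (fun c : config N D => overleftarrow
  (size (config_shape N (config_fun c)).1)
        (config_term x theta N (config_fun c)) *
      hsuper_fin N (config_shape N (config_fun c)).1
        (config_shape N (config_fun c)).2)) //.
by move=> c /eqP ->.
Qed.

Lemma kernel_term_support m N D :
  (forall k j, N <= j -> ((k, j) \notin m.1) && ((k, j) \notin m.2))%N ->
  (forall a, m.1 a <= D)%N ->
  sum_support m [set: superpartition]%classic kernel_term (config_shapes N D).
Proof.
move=> mN mD; split=> //; first exact: undup_uniq.
move=> L _ nL; have := kernel_term_eqmod L mN mD.
by rewrite big_pred0 // => c; apply: contraNF nL => /eqP/mem_config_shapes.
Qed.

(** After exchanging the sums, a configuration is counted once, for the superpartition that is its
    shape, or never when its shape repeats a fermionic part and its product is 0. *)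
Lemma sum_kernel_terms_eqmod m N D :
  (forall k j, N <= j -> ((k, j) \notin m.1) && ((k, j) \notin m.2))%N ->
  (forall a, m.1 a <= D)%N ->
  eqmod m (\sum_(L <- config_shapes N D) kernel_term L)
    (\sum_(c : config N D) \prod_(i <- iota 0 N)
      config_factor x theta (hfin R N) (htfin R N) (config_fun c) i).
Proof.
move=> mN mD; have := @eqmod_sum R m _ (config_shapes N D) _ _
  (fun L _ => kernel_term_eqmod L mN mD).
move=> /eqmod_trans; apply; rewrite (exchange_big_dep xpredT) //=.
set LHS := (X in eqmod _ X _); set RHS := (X in eqmod _ _ X).
suff -> : LHS = RHS by [].
apply: eq_bigr => c _; rewrite prod_config_fin.
set sh := config_shape N (config_fun c); case: ifPn => ush; last first.
  rewrite big_pred0 // => L; apply: contraNF ush => /eqP shL.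
  have [] := superpartitionP L; rewrite gtn_sorted_uniq_geq /fermionic -shL.
  by case/andP.
have shP : [&& sorted gtn sh.1, sorted geq sh.2 & 0%N \notin sh.2].
  have [s1 s2] := config_shape_sorted N (config_fun c).
  by rewrite gtn_sorted_uniq_geq ush s1 s2 config_shape_bosonic.
pose L0 := SuperPartition shP.
rewrite (eq_bigl (pred1 L0)) => [|L]; last by rewrite /= eq_sym.
rewrite -big_filter filter_pred1_uniq ?big_seq1 ?undup_uniq //.
exact: mem_config_shapes.
Qed.

End KernelExpansion.

Theorem proposition34 (R : comNzRingType) :
  let factor (ij : nat * nat) : superseries R :=
    (1 - xvar R ij.1 * yvar R ij.2 - thetavar R ij.1 * phivar R ij.2)^-1 in
  let term (L : superpartition) : superseries R :=
    overleftarrow (size (fermionic L)) (smonomial (xvar R) (thetavar R) L) *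
    hsuper (yvar R) (phivar R) L in
  [/\ multipliable factor,
      summable [set: superpartition]%classic term
    & infprod factor = infsum [set: superpartition]%classic term].
Proof.
move=> factor term.
(* A factor outside the square involves a pair of variables absent from [m]. *)
have supp m N :
    (forall k j, N <= j -> ((k, j) \notin m.1) && ((k, j) \notin m.2))%N ->
    prod_support m factor [seq (i, j) | i <- iota 0 N, j <- iota 0 N].
  move=> mN; split; first by apply: allpairs_uniq; rewrite ?iota_uniq // => -[? ?] [].
  move=> [i j] ij; apply: kernel_factor_eqmod1.
  have [iN|/mN -> //] := ltnP i N; have [jN|/mN ->] := ltnP j N; last by rewrite orbT.
  by case/negP: ij; apply: allpairs_f; rewrite mem_iota.
have [||mult prodE] := @infprod_eqmod R _ factor.
- by move=> i j; apply: kernel_factor_central.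
- by move=> m; have [N mN] := letter_bound m; eexists; apply: supp mN.
have [|summ sumE] := @infsum_eqmod R _ [set: superpartition]%classic term.
  move=> m; have [N mN] := letter_bound m; have [D mD] := mult_bound m.
  by eexists; apply: kernel_term_support mN mD.
(* For each [m], both sides are congruent to the same finite sum over configurations. *)
split=> //; apply: eqmod_all => m.
have [N mN] := letter_bound m; have [D mD] := mult_bound m.
apply: (eqmod_trans (prodE _ _ (supp _ _ mN))).
refine (eqmod_trans (kernel_eqmod R mN mD) _); apply: eqmod_sym.
apply: (eqmod_trans (sumE _ _ (kernel_term_support R mN mD))).
exact: sum_kernel_terms_eqmod.
Qed.
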